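(* Let $A$ be a locally $C^*$-algebra and let $E$ and $F$ be Hilbert $A$-modules. Then $E$ and $F$ are unitarily equivalent if and only if there is an element $T\in L_A(E,F)$ such that $T$ and $T^*$ both have dense range.
   Context: A locally $C^*$-algebra is a complete Hausdorff complex topological $*$-algebra $A$ whose topology is determined by its continuous $C^*$-seminorms: a net $(a_i)$ converges to $0$ iff $p(a_i)\to 0$ for every continuous $C^*$-seminorm $p$. $S(A)$ denotes the set of all continuous $C^*$-seminorms on $A$. A pre-Hilbert $A$-module is a complex vector space $E$ that is also a right $A$-module (compatible with the complex algebra structure), with an $A$-valued inner product $\langle\cdot,\cdot\rangle:E\times E\to A$ that is $\mathbb{C}$- and $A$-linear in the second variable and satisfies $\langle\xi,\eta\rangle^*=\langle\eta,\xi\rangle$, $\langle\xi,\xi\rangle\ge 0$, and $\langle\xi,\xi\rangle=0$ iff $\xi=0$. It is a Hilbert $A$-module if it is complete for the topology given by the seminorms $\overline{p}_E(\xi)=\sqrt{p(\langle\xi,\xi\rangle)}$, $p\in S(A)$. Density is with respect to this topology. $L_A(E,F)$ is the set of adjointable $A$-module homomorphisms $T:E\to F$, with adjoint $T^*\in L_A(F,E)$. $U\in L_A(E,F)$ is unitary if $U^*U=\mathrm{id}_E$ and $UU^*=\mathrm{id}_F$. $E$ and $F$ are unitarily equivalent if there is a unitary operator in $L_A(E,F)$. *)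

(* Defs.v *)
From HB Require Import structures.
From mathcomp Require Import all_boot all_order all_algebra.
From mathcomp Require Import all_classical all_reals all_analysis.
From mathcomp Require Import complex.

Set Implicit Arguments.
Unset Strict Implicit.
Unset Printing Implicit Defensive.

Import Order.TTheory GRing.Theory Num.Theory.
Import numFieldNormedType.Exports.

Local Open Scope classical_set_scope.
Local Open Scope complex_scope.
Local Open Scope ring_scope.

(** Complex *-algebras.  MathComp rings have a unit, whereas locally
    C*-algebras need not have one, so the product is declared separately. *)

HB.mixin Record Lmodule_isStarAlgebra (R : realType) A
    & GRing.Lmodule R[i] A := {
  amul : A -> A -> A ;
  star : A -> A ;
  amulA : associative amul ;
  amulDl : left_distributive amul +%R ;
  amulDr : right_distributive amul +%R ;
  amulZl : forall (k : R[i]) a b, amul (k *: a) b = k *: amul a b ;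
  amulZr : forall (k : R[i]) a b, amul a (k *: b) = k *: amul a b ;
  starK : involutive star ;
  starD : {morph star : a b / a + b} ;
  starZ : forall (k : R[i]) a, star (k *: a) = k^* *: star a ;
  starM : forall a b, star (amul a b) = amul (star b) (star a)
}.

#[short(type="starAlgType")]
HB.structure Definition StarAlgebra (R : realType) :=
  {A of GRing.Lmodule R[i] A & Lmodule_isStarAlgebra R A}.

(** Completeness without the base point that [completeType] requires: over a
    pointed type, [exists l, F --> l] is [cvg F] (lemma [cvg_ex]). *)
Definition complete_uniform (T : uniformType) :=
  forall F : set_system T, ProperFilter F -> cauchy F -> exists l : T, F --> l.

(** A topological *-algebra carries the uniform structure of its additive
    group: uniform continuity of the subtraction forces the entourages to be
    the sets containing some [{(x, y) | x - y \in U}] with [U] a neighbourhood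
    of 0.  (The library's [tvsType] does not relate the uniform structure to
    the addition, so that a [tvsType] may be complete as a uniform space without
    being complete as a topological vector space.) *)

HB.mixin Record isTopologicalStarAlgebra (R : realType) A
    & Uniform A & StarAlgebra R A := {
  subr_unif_continuous : unif_continuous (fun z : A * A => z.1 - z.2) ;
  scaler_continuous : continuous (fun z : R[i]^o * A => z.1 *: z.2) ;
  amul_continuous : continuous (fun z : A * A => amul z.1 z.2) ;
  star_continuous : continuous (star : A -> A)
}.

#[short(type="topologicalStarAlgType")]
HB.structure Definition TopologicalStarAlgebra (R : realType) :=
  {A of StarAlgebra R A & Uniform A & isTopologicalStarAlgebra R A}.

Definition cstar_seminorm (R : realType) (A : starAlgType R) (p : A -> R) :=
  [/\ forall a b, p (a + b) <= p a + p b,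
      forall (k : R[i]) a, p (k *: a) = ComplexField.Normc.normc k * p a,
      forall a b, p (amul a b) <= p a * p b
    & forall a, p (amul (star a) a) = p a ^+ 2].

Definition continuous_cstar_seminorms (R : realType)
    (A : topologicalStarAlgType R) : set (A -> R) :=
  [set p | cstar_seminorm p /\ continuous p].

HB.mixin Record isLocallyCstar (R : realType) A
    & TopologicalStarAlgebra R A := {
  locally_cstar_complete : complete_uniform A ;
  locally_cstar_hausdorff : hausdorff_space A ;
  (* proper filters play the role of nets *)
  cvg0_cstar_seminormsP : forall F : set_system A, ProperFilter F ->
    F --> (0 : A) <->
    (forall p : A -> R, continuous_cstar_seminorms p -> p @ F --> (0 : R))
}.

#[short(type="locallyCstarType")]
HB.structure Definition LocallyCstar (R : realType) :=
  {A of TopologicalStarAlgebra R A & isLocallyCstar R A}.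

Definition positive (R : realType) (A : starAlgType R) (a : A) :=
  exists b : A, a = amul (star b) b.

HB.mixin Record Lmodule_isPreHilbert (R : realType) (A : locallyCstarType R) E
    & GRing.Lmodule R[i] E := {
  ract : E -> A -> E ;
  ractDl : forall x y a, ract (x + y) a = ract x a + ract y a ;
  ractDr : forall x a b, ract x (a + b) = ract x a + ract x b ;
  ractZl : forall (k : R[i]) x a, ract (k *: x) a = k *: ract x a ;
  ractZr : forall (k : R[i]) x a, ract x (k *: a) = k *: ract x a ;
  ractM : forall x a b, ract x (amul a b) = ract (ract x a) b ;
  inner : E -> E -> A ;
  innerDr : forall x y z, inner x (y + z) = inner x y + inner x z ;
  innerZr : forall (k : R[i]) x y, inner x (k *: y) = k *: inner x y ;
  inner_ract : forall x y a, inner x (ract y a) = amul (inner x y) a ;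
  inner_star : forall x y, star (inner x y) = inner y x ;
  inner_positive : forall x, positive (inner x x) ;
  inner_eq0 : forall x, inner x x = 0 <-> x = 0
}.

#[short(type="preHilbertModType")]
HB.structure Definition PreHilbert (R : realType) (A : locallyCstarType R) :=
  {E of GRing.Lmodule R[i] E & Lmodule_isPreHilbert R A E}.

Definition hseminorm (R : realType) (A : locallyCstarType R)
    (E : preHilbertModType A) (p : A -> R) (x : E) : R :=
  Num.sqrt (p (inner x x)).

(** The balls of single seminorms form a basis of the uniform structure, since
    [continuous_cstar_seminorms A] is closed under pointwise maximum. *)

HB.mixin Record PreHilbert_isHilbert (R : realType) (A : locallyCstarType R) E
    & Uniform E & PreHilbert R A E := {
  hilbert_entourageE : @entourage E =
    filter_from
      [set pe : (A -> R) * R | continuous_cstar_seminorms pe.1 /\ 0 < pe.2]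
      (fun pe => [set xy : E * E | hseminorm pe.1 (xy.1 - xy.2) < pe.2]) ;
  hilbert_complete : complete_uniform E
}.

#[short(type="hilbertModType")]
HB.structure Definition HilbertModule (R : realType) (A : locallyCstarType R) :=
  {E of PreHilbert R A E & Uniform E & PreHilbert_isHilbert R A E}.

(** [adjointable E F] is L_A(E, F).  The map [adj] is determined by [op], see
    [adjointable_inj]. *)
Record adjointable (R : realType) (A : locallyCstarType R)
    (E F : preHilbertModType A) := Adjointable {
  op :> {linear E -> F} ;
  op_ract : forall x a, op (ract x a) = ract (op x) a ;
  adj : F -> E ;
  adjP : forall x y, inner (op x) y = inner x (adj y)
}.

Section adjoint.
Context (R : realType) (A : locallyCstarType R).

Lemma inner_inj (E : preHilbertModType A) (u v : E) :
  (forall x, inner x u = inner x v) -> u = v.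
Proof.
move=> uv; apply/subr0_eq/inner_eq0.
by rewrite innerDr -scaleN1r innerZr uv -innerZr -innerDr scaleN1r subrr
  -(scale0r (0 : E)) innerZr scale0r.
Qed.

Context (E F : preHilbertModType A).

Lemma adjointable_inj (S T : adjointable E F) :
  op S =1 op T -> adj S =1 adj T.
Proof. by move=> ST y; apply: inner_inj => x; rewrite -!adjP ST. Qed.

Variable T : adjointable E F.

Let adj_linear : linear (adj T).
Proof.
move=> k y z; apply: inner_inj => x.
by rewrite innerDr innerZr -!adjP innerDr innerZr.
Qed.

HB.instance Definition _ :=
  GRing.isLinear.Build R[i] F E _ (adj T) adj_linear.

Let adj_ract (y : F) (a : A) : adj T (ract y a) = ract (adj T y) a.
Proof. by apply: inner_inj => x; rewrite inner_ract -!adjP inner_ract. Qed.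

Let adj_op (y : F) (x : E) : inner (adj T y) x = inner y (T x).
Proof. by rewrite -inner_star -adjP inner_star. Qed.

Definition adjoint : adjointable F E :=
  @Adjointable R A F E (adj T) adj_ract T adj_op.

Definition unitary := adjoint \o T = id /\ T \o adjoint = id.

End adjoint.

Definition unitarily_equivalent (R : realType) (A : locallyCstarType R)
    (E F : preHilbertModType A) :=
  exists U : adjointable E F, unitary U.

(* Main.v *)
Require Import Defs.
From HB Require Import structures.
From mathcomp Require Import all_boot all_order all_algebra.
From mathcomp Require Import all_classical all_reals all_analysis.
From mathcomp Require Import complex ring lra.

Set Implicit Arguments.
Unset Strict Implicit.
Unset Printing Implicit Defensive.

Import Order.TTheory GRing.Theory Num.Theory.
Import numFieldNormedType.Exports.

Local Open Scope classical_set_scope.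
Local Open Scope complex_scope.
Local Open Scope ring_scope.

(** The converse runs by polar decomposition. The operator
    [Z = T (1 + T^* T)^-1] has the same ranges as [T], its adjoint the same as
    [T^*], and it is a contraction for every seminorm; so [|Z| = (Z^* Z)^(1/2)]
    is a limit of polynomials in [Z^* Z], and [|Z| x |-> Z x] extends to a
    unitary.

    Two points need care. Positivity of [b^* b] and everything derived from it
    (the order on [A], the Cauchy-Schwarz inequality) is proved for one
    C*-seminorm at a time, without unit, completeness or spectrum: spectral
    statements become norm bounds for real polynomials in one self-adjoint
    element, acting on [A] by left multiplication, and the only limit used is
    the iteration [Y := (k + Y^2) / 2] for [1 - (1 - k)^(1/2)]. Adjointable
    maps are bounded for each seminorm by a gliding hump argument, since
    [d (1 + <d,d>)^-1] is an approximation of [d] that is bounded uniformly in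
    all seminorms. *)

(** The bound of [T] depends on the seminorm, so no single scalar makes [T] a contraction for all
    seminorms at once, and the square root iteration, which needs bound 1, cannot be run on [T^* T]
    itself. The resolvent removes this dependence. To build it, a bound [c] of [T] for [p] is turned
    into the bound [c^2] for [c^2 - T^* T]; this makes [1 + T^* T] bounded below and gives a
    geometric iteration for its inverse. The ratio still varies with [p], so the solutions obtained
    for different seminorms are glued by completeness. Staying in [A] instead of passing to the
    quotient by the kernel of a seminorm is why positivity always carries a tolerance [e]. *)

(** * Real polynomials of a linear map *)

Section real_polynomial_of_operator.
Context (R : realType) (X : lmodType R[i]) (h : {linear X -> X}).
Implicit Types (f g : {poly R}) (x y : X).

(** Coefficients are real so that polynomials in a self-adjoint map stay self-adjoint. The module is
    [A] in the positivity proofs and [E] in the operator proofs. *)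
Definition horner_op f x : X := \sum_(i < size f) (f`_i)%:C *: iter i h x.

Lemma horner_opE n f x : (size f <= n)%N ->
  horner_op f x = \sum_(i < n) (f`_i)%:C *: iter i h x.
Proof.
move=> fn; rewrite /horner_op -(subnKC fn) big_split_ord /= [X in _ = _ + X]big1 ?addr0//.
by move=> i _; rewrite nth_default ?leq_addr// scale0r.
Qed.

Lemma horner_opD f g x : horner_op (f + g) x = horner_op f x + horner_op g x.
Proof.
pose n := maxn (size f) (size g).
rewrite (@horner_opE n) ?size_polyD// (@horner_opE n f) ?leq_maxl//.
rewrite (@horner_opE n g) ?leq_maxr// -big_split; apply: eq_bigr => i _.
by rewrite coefD rmorphD scalerDl.
Qed.

Lemma horner_opC c x : horner_op c%:P x = c%:C *: x.
Proof.
by rewrite (@horner_opE 1) ?size_polyC ?leq_b1// big_ord1 coefC.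
Qed.

Lemma horner_op_linear f : linear (horner_op f).
Proof.
move=> k x y; rewrite /horner_op scaler_sumr -big_split; apply: eq_bigr => i _ /=.
have iterP n : iter n h (k *: x + y) = k *: iter n h x + iter n h y.
  by elim: n => //= n ->; rewrite linearP.
by rewrite iterP scalerDr !scalerA mulrC.
Qed.

Lemma horner_opMX f x : horner_op (f * 'X) x = h (horner_op f x).
Proof.
rewrite (@horner_opE (size f).+1); last first.
  by rewrite (leq_trans (size_polyMleq _ _))// size_polyX addn2.
rewrite big_ord_recl coefMX/= scale0r add0r linear_sum; apply: eq_bigr => i _.
by rewrite coefMX linearZ.
Qed.

Lemma horner_op_opD f x y : horner_op f (x + y) = horner_op f x + horner_op f y.
Proof. by rewrite -[x]scale1r horner_op_linear !scale1r. Qed.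

Lemma horner_op_op0 f : horner_op f 0 = 0.
Proof. by apply: (addrI (horner_op f 0)); rewrite -horner_op_opD !addr0. Qed.

Lemma horner_op_opZ f k x : horner_op f (k *: x) = k *: horner_op f x.
Proof. by rewrite -[k *: x]addr0 horner_op_linear horner_op_op0 addr0. Qed.

Lemma horner_op0 x : horner_op 0 x = 0.
Proof. by rewrite -polyC0 horner_opC scale0r. Qed.

Lemma horner_opZ c f x : horner_op (c *: f) x = c%:C *: horner_op f x.
Proof.
rewrite (@horner_opE (size f)) ?size_scale_leq// /horner_op scaler_sumr.
by apply: eq_bigr => i _; rewrite coefZ rmorphM scalerA.
Qed.

Lemma horner_op_comm f x : horner_op f (h x) = h (horner_op f x).
Proof.
elim/poly_ind: f => [|f c IH]; first by rewrite !horner_op0 linear0.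
by rewrite !horner_opD !horner_opMX !horner_opC IH linearD linearZ.
Qed.

Lemma horner_opM f g x : horner_op (f * g) x = horner_op f (horner_op g x).
Proof.
elim/poly_ind: g => [|g c IH]; first by rewrite mulr0 !horner_op0 horner_op_op0.
rewrite mulrDr mulrA !horner_opD !horner_opMX IH horner_opC horner_op_opD.
by rewrite horner_op_comm [f * _]mulrC mul_polyC horner_opZ horner_op_opZ.
Qed.

Lemma horner_opX x : horner_op 'X x = h x.
Proof. by rewrite -[X in horner_op X]mul1r horner_opMX -polyC1 horner_opC scale1r. Qed.

Lemma horner_op_subX t x : horner_op (t%:P - 'X) x = t%:C *: x - h x.
Proof.
rewrite horner_opD horner_opC -mulN1r -polyC1 -polyCN horner_opM horner_opC.
by rewrite horner_opX rmorphN scaleN1r.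
Qed.

End real_polynomial_of_operator.

(** * Approximate square roots *)

Section visser_iteration.
Context (R : realType).
Implicit Types (k : {poly R}) (n : nat).

(* [1 - visser k n] tends to the square root of [1 - k]; [vissr] is the scalar
   iteration with [k = 1]. *)
Fixpoint visser k n : {poly R} :=
  if n is m.+1 then (2^-1)%:P * (k + visser k m ^+ 2) else 0.

Fixpoint vissr n : R := if n is m.+1 then 2^-1 * (1 + vissr m ^+ 2) else 0.

Lemma visserS k n : visser k n.+1 = (2^-1)%:P * (k + visser k n ^+ 2).
Proof. by []. Qed.

Lemma vissrS n : vissr n.+1 = 2^-1 * (1 + vissr n ^+ 2).
Proof. by []. Qed.

Lemma vissr_itv n : 0 <= vissr n <= 1.
Proof. by elim: n => [|n /andP[y0 y1]] /=; [lra|apply/andP; split; nra]. Qed.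

Lemma vissr_step n : vissr n.+1 - vissr n = 2^-1 * (1 - vissr n) ^+ 2.
Proof. by rewrite /=; lra. Qed.

Lemma vissr_nondecr n : vissr n <= vissr n.+1.
Proof. by rewrite -subr_ge0 vissr_step mulr_ge0// ?sqr_ge0// invr_ge0. Qed.

(** The step [vissr n.+1 - vissr n = (1 - vissr n)^2 / 2] decreases with [n], so [n + 1] copies of
    the last one are at most the telescoping sum [vissr n.+1], which is at most 1. *)
Lemma vissr_cvg1 n : n.+1%:R * (1 - vissr n) ^+ 2 <= 2.
Proof.
suff H m : m.+1%:R * (1 - vissr m) ^+ 2 <= 2 * vissr m.+1.
  by have := H n; have := vissr_itv n.+1; lra.
elim: m => [|m IH]; first by rewrite /= expr0n/=; lra.
have := vissr_nondecr m; have := vissr_itv m; have := vissr_itv m.+1.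
have := vissr_step m.+1; rewrite -[in m.+2%:R]addn1 natrD.
move: (vissr m.+2) (vissr m.+1) (vissr m) IH => c b a; set u := m.+1%:R.
have : 0 <= u by rewrite ler0n.
move=> u0 IH cb b01 a01 ab.
have : u * (1 - b) ^+ 2 <= u * (1 - a) ^+ 2 by rewrite ler_wpM2l// !expr2; nra.
by nra.
Qed.

Lemma vissr_cvg1P (e : R) : 0 < e -> exists n, 1 - vissr n <= e.
Proof.
move=> e0; have e20 : 0 < e ^+ 2 by rewrite exprn_gt0.
have [n ne] : exists n, 2 / e ^+ 2 < n%:R.
  by exists (Num.bound (2 / e ^+ 2)); rewrite archi_boundP// divr_ge0// ltW.
exists n; have /andP[_ y1] := vissr_itv n.
rewrite -(@ler_pXn2r _ 2)// ?nnegrE ?subr_ge0 ?(ltW e0)//.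
rewrite -(ler_pM2l (ltr0Sn R n)); apply: le_trans (vissr_cvg1 n) _.
by move: ne; rewrite ltr_pdivrMr// -natr1 => /ltW; nra.
Qed.

(** The defect of [1 - visser k n] as a root of [1 - k] is, up to sign, twice a step of the
    iteration; small steps alone give approximate roots, with no limit in the algebra. *)
Lemma visser_sqrt k n :
  1 - k - (1 - visser k n) ^+ 2 = 2%:P * (visser k n - visser k n.+1).
Proof.
have : (2 : R)%:P * (2^-1)%:P = 1 by rewrite -polyCM divff.
rewrite /= mulrBr mulrA => ->; rewrite (_ : (2 : R)%:P = 2); first by ring.
by rewrite -[2 in RHS]/(2%:R) -polyC_natr.
Qed.

End visser_iteration.

(** * Norm bounds and approximate positivity for polynomials in one operator *)

Section operator_bound.
Context (R : realType) (X : lmodType R[i]) (nu : X -> R) (h : {linear X -> X}).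
Implicit Types (f g : {poly R}) (c d : R) (x y : X).

Definition op_bound f c := forall x, nu (horner_op h f x) <= c * nu x.

Hypothesis nuD : forall x y, nu (x + y) <= nu x + nu y.
Hypothesis nuZ : forall (a : R) x, nu (a%:C *: x) = `|a| * nu x.

Lemma seminorm0 : nu 0 = 0.
Proof. by rewrite -(scale0r (0 : X)) (nuZ 0) normr0 mul0r. Qed.

Lemma seminorm_ge0 x : 0 <= nu x.
Proof.
have := nuD x ((- 1)%:C *: x).
rewrite nuZ rmorphN rmorph1 scaleN1r subrr seminorm0 normrN normr1 mul1r.
by lra.
Qed.

Lemma op_bound_const a : op_bound a%:P `|a|.
Proof. by move=> x; rewrite horner_opC nuZ. Qed.

Lemma op_boundD f g c d : op_bound f c -> op_bound g d -> op_bound (f + g) (c + d).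
Proof.
by move=> fc gd x; rewrite horner_opD mulrDl (le_trans (nuD _ _))// lerD.
Qed.

Lemma op_boundM f g c d : 0 <= c ->
  op_bound f c -> op_bound g d -> op_bound (f * g) (c * d).
Proof.
move=> c0 fc gd x; rewrite horner_opM -mulrA.
by rewrite (le_trans (fc _))// ler_wpM2l.
Qed.

Lemma op_bound_le f c d : c <= d -> op_bound f c -> op_bound f d.
Proof.
by move=> cd fc x; rewrite (le_trans (fc x))// ler_wpM2r// seminorm_ge0.
Qed.

Lemma op_bound_eq f g c d : op_bound f c -> f = g -> c <= d -> op_bound g d.
Proof. by move=> fc <- cd; exact: op_bound_le fc. Qed.

Lemma op_bound1 : op_bound 1 1.
Proof. by have := op_bound_const 1; rewrite polyC1 normr1. Qed.

Lemma op_boundZ a f c : op_bound f c -> op_bound (a%:P * f) (`|a| * c).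
Proof. by move=> fc; apply: op_boundM => //; exact: op_bound_const. Qed.

Lemma op_boundN f c : op_bound f c -> op_bound (- f) c.
Proof.
move=> /(op_boundZ (-1)) fc; apply: op_bound_eq fc _ _; last first.
  by rewrite normrN normr1 mul1r.
by rewrite polyCN polyC1 mulN1r.
Qed.

Lemma op_boundB f g c d : op_bound f c -> op_bound g d -> op_bound (f - g) (c + d).
Proof. by move=> fc /op_boundN; exact: op_boundD. Qed.

Lemma op_bound_lim f c : (forall e, 0 < e -> op_bound f (c + e)) -> op_bound f c.
Proof.
move=> fc x; apply/ler_addgt0Pr => e e0; have x0 := seminorm_ge0 x.
have x1 : 0 < nu x + 1 by lra.
have := fc (e / (nu x + 1)) (divr_gt0 e0 x1) x.
move=> /le_trans; apply; rewrite mulrDl lerD2l mulrAC ler_pdivrMr//.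
by rewrite ler_pM2l//; lra.
Qed.

Lemma visser_bound k n : op_bound k 1 -> op_bound (visser k n) (vissr R n).
Proof.
move=> k1; elim: n => [|n IH] /=.
  by rewrite -polyC0; apply: op_bound_eq (op_bound_const 0) _ _; rewrite ?normr0.
have /andP[y0 _] := vissr_itv R n.
have := op_boundZ (2^-1) (op_boundD k1 (op_boundM y0 IH IH)).
by move=> /op_bound_eq; apply=> //; rewrite ger0_norm// invr_ge0.
Qed.

(** As [Y_{n+2} - Y_{n+1} = (Y_{n+1} + Y_n) (Y_{n+1} - Y_n) / 2], induction dominates each step by
    the same step of the scalar iteration. *)
Lemma visser_step_bound k n : op_bound k 1 ->
  op_bound (visser k n.+1 - visser k n) (vissr R n.+1 - vissr R n).
Proof.
move=> k1; elim: n => [|n IH].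
  by rewrite subr0 [vissr R 0]/= subr0; exact: visser_bound.
have /andP[y0 _] := vissr_itv R n; have /andP[y1 _] := vissr_itv R n.+1.
have b0 := visser_bound n k1; have b1 := visser_bound n.+1 k1.
have := op_boundZ (2^-1) (op_boundM (addr_ge0 y1 y0) (op_boundD b1 b0) IH).
move=> /op_bound_eq; apply.
  transitivity ((2^-1)%:P * (k + visser k n.+1 ^+ 2) -
    (2^-1)%:P * (k + visser k n ^+ 2)); last by rewrite -!visserS.
  by move: (visser k n.+1) => b; ring.
have -> : vissr R n.+2 - vissr R n.+1 =
    2^-1 * (1 + vissr R n.+1 ^+ 2) - 2^-1 * (1 + vissr R n ^+ 2).
  by rewrite -!vissrS.
rewrite ger0_norm ?invr_ge0//.
by move: (vissr R n.+1) => b; lra.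
Qed.

Lemma visser_diff_bound k m n : op_bound k 1 -> (m <= n)%N ->
  op_bound (visser k n - visser k m) (vissr R n - vissr R m).
Proof.
move=> k1 /subnKC <-; elim: (n - m)%N => [|d IH].
  by rewrite addn0 !subrr; apply: op_bound_eq (op_bound_const 0) _ _; rewrite ?normr0.
rewrite addnS; have := op_boundD (visser_step_bound (m + d) k1) IH.
by move=> /op_bound_eq; apply; [ring|lra].
Qed.

Lemma op_bound_sqrt k e : op_bound k 1 -> 0 < e ->
  exists g, op_bound g 1 /\ op_bound (1 - k - (1 - g) ^+ 2) e.
Proof.
move=> k1 e0; have e20 : 0 < Num.min e 1 by rewrite lt_min e0/=.
have [n ne] := vissr_cvg1P e20; exists (visser k n); split.
  by apply: op_bound_le (visser_bound n k1); have /andP[] := vissr_itv R n.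
rewrite visser_sqrt -opprB mulrN; apply: op_boundN.
have := op_boundZ 2 (visser_step_bound n k1) => /op_bound_le; apply.
rewrite vissr_step ger0_norm// mulrA divff// mul1r.
have /andP[_ y1] := vissr_itv R n.
by move: ne; rewrite le_min => /andP[]; nra.
Qed.

(** This is the form in which the C*-identity enters for commuting self-adjoint operators: a square
    is dominated by a sum of squares. *)
Hypothesis op_bound_cstar : forall f g c, 0 <= c ->
  op_bound (f ^+ 2 + g ^+ 2) (c ^+ 2) -> op_bound f c.

(** Positive means a limit of squares. Polynomials in one operator commute, so a product of two
    squares is again a square. *)
Definition op_pos f :=
  forall e, 0 < e -> exists s, op_bound (f - s ^+ 2) e.

Lemma op_pos_sqr f : op_pos (f ^+ 2).
Proof.
move=> e e0; exists f; rewrite subrr -polyC0.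
by apply: op_bound_eq (op_bound_const 0) _ _; rewrite ?normr0 ?ltW.
Qed.

(** With [k = 1 - f / c] bounded by 1, the iteration gives an approximate root of [1 - k = f / c],
    which is then scaled by the root of [c]. *)
Lemma op_pos_ball f c : 0 < c -> op_bound (c%:P - f) c -> op_pos f.
Proof.
move=> c0 fc e e0; have c'0 : 0 <= c^-1 by rewrite invr_ge0 ltW.
have k1 : op_bound (1 - (c^-1)%:P * f) 1.
  have := op_boundZ c^-1 fc => /op_bound_eq; apply; last first.
    by rewrite ger0_norm// mulVf ?gt_eqF.
  by rewrite mulrBr -polyCM mulVf ?gt_eqF.
have [y [_ ye]] := op_bound_sqrt k1 (divr_gt0 e0 c0).
exists ((Num.sqrt c)%:P * (1 - y)).
have := op_boundZ c ye => /op_bound_eq; apply; last first.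
  by rewrite gtr0_norm// mulrCA divff ?mulr1 ?gt_eqF.
have : c%:P * (c^-1)%:P = 1 :> {poly R} by rewrite -polyCM divff ?gt_eqF.
have : (Num.sqrt c)%:P ^+ 2 = c%:P :> {poly R}.
  by rewrite -polyC_exp sqr_sqrtr// ltW.
by move: (_%:P) (_%:P) (_%:P) => a b d <- H; ring: H.
Qed.

Lemma op_posM f g c d : op_bound f c -> op_bound g d ->
  op_pos f -> op_pos g -> op_pos (f * g).
Proof.
move=> fc gd fp gp e e0.
have c1 : 0 < `|c| + 1 by rewrite ltr_wpDl.
have d1 : 0 < `|d| + 1 by rewrite ltr_wpDl.
(* The error is [(f - s^2) g + s^2 (g - r^2)]; the minimum with 1 keeps [s^2] bounded by
   [|c| + 1]. *)
have [s sf] := fp (Num.min 1 (e / (2 * (`|d| + 1))))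
  (ltac:(rewrite lt_min ltr01 divr_gt0// mulr_gt0//)).
have [r rg] := gp (e / (2 * (`|c| + 1))) (ltac:(rewrite divr_gt0// mulr_gt0//)).
exists (s * r).
have s1 : op_bound (s ^+ 2) (`|c| + 1).
  apply: op_bound_eq (op_boundB fc sf) _ _; first by ring.
  by rewrite lerD ?ler_norm// ge_min lexx.
have sf' : op_bound (f - s ^+ 2) (e / (2 * (`|d| + 1))).
  by apply: op_bound_le sf; rewrite ge_min lexx orbT.
have gd' : op_bound g (`|d| + 1).
  by apply: op_bound_le gd; rewrite (le_trans (ler_norm d))// lerDl.
have := op_boundD (op_boundM _ sf' gd') (op_boundM (ltW c1) s1 rg).
move=> /(_ (ltac:(by rewrite ltW// divr_gt0// mulr_gt0))).
move=> /op_bound_eq; apply; first by ring.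
rewrite le_eqVlt; apply/orP; left; apply/eqP; field.
by rewrite !gt_eqF.
Qed.

(** As [f (c - f)] is nearly a square [s^2], [(f - c/2)^2 + s^2] is nearly [c^2/4], and
    [op_bound_cstar] bounds [f - c/2] by about [c/2]. The tolerance [e^2] fits because
    [c^2/4 + e^2 <= (c/2 + e)^2]. *)
Lemma op_pos_interval f c d : 0 <= c -> op_bound f d ->
  op_pos f -> op_pos (c%:P - f) -> op_bound f c.
Proof.
move=> c0 fd fp gp; apply: op_bound_lim => e e0.
have gd : op_bound (c%:P - f) (`|c| + d) by apply: op_boundB fd; exact: op_bound_const.
have [s sP] := op_posM fd gd fp gp (exprn_gt0 2 e0).
have ce0 : 0 <= c / 2 + e by lra.
have : op_bound (f - (c / 2)%:P) (c / 2 + e).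
  apply: (op_bound_cstar (g := s)) => //.
  apply: op_bound_eq (op_boundB (op_bound_const ((c / 2) ^+ 2)) sP) _ _.
    rewrite polyC_exp; have : c%:P = (c / 2)%:P + (c / 2)%:P :> {poly R}.
      by rewrite -polyCD; congr _%:P; lra.
    by move: (_%:P) (_%:P) => a b ->; ring.
  by rewrite ger0_norm ?sqr_ge0//; nra.
move=> /(op_boundD (op_bound_const (c / 2))) /op_bound_eq; apply; first by ring.
by rewrite ger0_norm; lra.
Qed.

Lemma op_pos_ball_ge f c : 0 < c -> op_pos f -> op_bound f c -> op_bound (c%:P - f) c.
Proof.
move=> c0 fp fc; apply: (@op_pos_interval _ _ (c + c)) => //; first exact: ltW.
- by apply: op_boundB fc; apply: op_bound_le (op_bound_const c); rewrite gtr0_norm.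
- by apply: op_pos_ball c0 _; rewrite opprB addrC subrK.
- by rewrite opprB addrC subrK.
Qed.

End operator_bound.

(** The pairing is abstract because it serves both for [a^* b] on the algebra and for the inner
    product of a module. *)
Lemma horner_op_adj (R : realType) (X V : lmodType R[i]) (h : {linear X -> X})
    (phi : X -> X -> V) (f : {poly R}) (x y : X) :
  (forall x x' y, phi (x + x') y = phi x y + phi x' y) ->
  (forall x y y', phi x (y + y') = phi x y + phi x y') ->
  (forall (a : R) x y, phi (a%:C *: x) y = a%:C *: phi x y) ->
  (forall (a : R) x y, phi x (a%:C *: y) = a%:C *: phi x y) ->
  (forall x y, phi (h x) y = phi x (h y)) ->
  phi (horner_op h f x) y = phi x (horner_op h f y).
Proof.
move=> phiDl phiDr phiZl phiZr hphi.
elim/poly_ind: f y => [|f c IH] y.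
  have := phiZr 0 x y; have := phiZl 0 x y.
  by rewrite !horner_op0 !scale0r => -> ->.
rewrite !horner_opD !horner_opMX !horner_opC phiDl phiDr hphi phiZl phiZr.
by rewrite IH horner_op_comm.
Qed.

Lemma conjc_realE (R : realType) (r : R) : (r%:C : R[i])^* = r%:C.
Proof. exact: conjc_real. Qed.

Lemma conjc_i (R : realType) : ('i : R[i])^* = - 'i.
Proof. by apply/eqP; rewrite eq_complex /= oppr0 !eqxx. Qed.

Lemma mulc_ii (R : realType) : 'i * 'i = -1 :> R[i].
Proof.
by apply/eqP; rewrite eq_complex /= !mul0r !mulr0 mulr1 sub0r oppr0 addr0 !eqxx.
Qed.

(** * C*-seminorms on a star algebra *)

Section star_algebra.
Context (R : realType) (A : starAlgType R).
Implicit Types (a b x y : A) (k : R[i]).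

Let amul_linear a : linear (amul a).
Proof. by move=> k x y; rewrite amulDr amulZr. Qed.

HB.instance Definition _ a :=
  GRing.isLinear.Build R[i] A A _ (amul a) (amul_linear a).

Let star_zmod_morphism : zmod_morphism (star : A -> A).
Proof. by move=> a b; rewrite -scaleN1r starD starZ rmorphN1 scaleN1r. Qed.

HB.instance Definition _ :=
  GRing.isZmodMorphism.Build A A (star : A -> A) star_zmod_morphism.

Lemma amul0l a : amul 0 a = 0.
Proof. by rewrite -(scale0r (0 : A)) amulZl !scale0r. Qed.

Lemma amulNl a b : amul (- a) b = - amul a b.
Proof. by rewrite -scaleN1r amulZl scaleN1r. Qed.

Lemma horner_amulMr a f x y :
  horner_op (amul a) f (amul x y) = amul (horner_op (amul a) f x) y.
Proof.
elim/poly_ind: f => [|f c IH]; first by rewrite !horner_op0 amul0l.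
by rewrite !horner_opD !horner_opMX !horner_opC IH/= amulDl amulA amulZl.
Qed.

Lemma horner_amul_adj a f x y : star a = a ->
  amul (star (horner_op (amul a) f x)) y = amul (star x) (horner_op (amul a) f y).
Proof.
move=> a_sa.
apply: (@horner_op_adj _ _ _ _ (fun x y => amul (star x) y)) => //.
- by move=> u v w; rewrite starD amulDl.
- by move=> u v w; rewrite amulDr.
- by move=> r u v; rewrite starZ amulZl conjc_realE.
- by move=> r u v; rewrite amulZr.
- by move=> u v /=; rewrite starM a_sa; exact: esym (amulA _ _ _).
Qed.

Section cstar_seminorm.
Context (p : A -> R) (pC : cstar_seminorm p).

Lemma cstarD a b : p (a + b) <= p a + p b.
Proof. by case: pC. Qed.

Lemma cstarZ (r : R) a : p (r%:C *: a) = `|r| * p a.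
Proof. by case: pC => _ -> _ _; rewrite /= expr0n addr0 sqrtr_sqr. Qed.

Lemma cstarM a b : p (amul a b) <= p a * p b.
Proof. by case: pC. Qed.

Lemma cstar_sqr a : p (amul (star a) a) = p a ^+ 2.
Proof. by case: pC. Qed.

Lemma cstar_ge0 a : 0 <= p a.
Proof. exact: seminorm_ge0 cstarD cstarZ a. Qed.

Lemma cstar0 : p 0 = 0.
Proof. exact: (@seminorm0 _ _ p cstarZ). Qed.

Lemma cstarN a : p (- a) = p a.
Proof. by rewrite -scaleN1r -(rmorphN1 (real_complex R)) cstarZ normrN1 mul1r. Qed.

Lemma cstar_star a : p (star a) = p a.
Proof.
suff le b : p b <= p (star b) by apply/eqP; rewrite eq_le le -{2}[a]starK le.
have := cstar_ge0 b; rewrite le_eqVlt => /predU1P[<-|b0]; first exact: cstar_ge0.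
by rewrite -(ler_pM2r b0) -expr2 -cstar_sqr cstarM.
Qed.

(** Testing at [x = star a], where [p (amul a (star a)) = p a ^+ 2], recovers [p a] from left
    multiplication without a unit. *)
Lemma cstar_le_op a c : 0 <= c -> (forall x, p (amul a x) <= c * p x) -> p a <= c.
Proof.
move=> c0 ac; have := cstar_ge0 a; rewrite le_eqVlt => /predU1P[<-//|a0].
rewrite -(ler_pM2r a0) -expr2 -{1}cstar_star -cstar_sqr starK.
by rewrite (le_trans (ac _))// cstar_star.
Qed.

(* [(f + i g)^* (f + i g) = f^2 + g^2] on polynomials in a self-adjoint [a]. *)
Lemma op_bound_cstar a f g c : star a = a -> 0 <= c ->
  op_bound p (amul a) (f ^+ 2 + g ^+ 2) (c ^+ 2) -> op_bound p (amul a) f c.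
Proof.
move=> a_sa c0 fg x.
pose F := horner_op (amul a) f; pose G := horner_op (amul a) g.
have H (j : R[i]) : j^* = - j -> j * j = -1 -> p (F x + j *: G x) <= c * p x.
  move=> jN jj; rewrite -(@ler_pXn2r _ 2)// ?nnegrE ?cstar_ge0 ?mulr_ge0 ?cstar_ge0//.
  rewrite -cstar_sqr starD starZ jN amulDl amulZl !horner_amul_adj//.
  rewrite -amulZr -amulDr.
  have -> : horner_op (amul a) f (F x + j *: G x) +
      - j *: horner_op (amul a) g (F x + j *: G x) =
      horner_op (amul a) (f ^+ 2 + g ^+ 2) x.
    rewrite !horner_op_opD !horner_op_opZ horner_opD !expr2 !horner_opM scalerDr.
    rewrite scalerA mulNr jj opprK scale1r -!horner_opM [g * f]mulrC scaleNr.
    by rewrite addrA addrK.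
  rewrite (le_trans (cstarM _ _))// cstar_star.
  by rewrite exprMn [p x ^+ 2]expr2 mulrCA ler_wpM2l ?cstar_ge0 ?fg.
have Hp := H 'i (conjc_i R) (mulc_ii R).
have Hm := H (- 'i) (ltac:(by rewrite -conjc_i conjCK conjc_i opprK))
  (ltac:(by rewrite mulrNN mulc_ii)).
rewrite scaleNr in Hm.
have := cstarD (F x + 'i *: G x) (F x - 'i *: G x).
rewrite addrACA subrr addr0 -(_ : 2%:C *: F x = F x + F x) ?cstarZ ?ger0_norm//; first by lra.
by rewrite -[in RHS](scale1r (F x)) -scalerDl; congr (_ *: _); rewrite -[RHS](rmorphD (real_complex R) 1 1).
Qed.

End cstar_seminorm.

End star_algebra.

(** * Approximate lower spectral bounds *)

Section fukamiya.
Context (R : realType) (A : starAlgType R) (p : A -> R) (pC : cstar_seminorm p).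
Implicit Types (a b c x y : A) (e d : R).

Let pD := cstarD pC.
Let pZ := cstarZ pC.

(* [cstar_lb a e] says that the spectrum of [a] modulo the kernel of [p] is
   bounded below by [-e]; no unit of [A] is used. *)
Definition cstar_lb a e :=
  exists2 t : R, 0 <= t & forall x, p (t%:C *: x - amul a x) <= (t + e) * p x.

Lemma cstar_lbP a e : cstar_lb a e <->
  exists2 t : R, 0 < t & op_bound p (amul a) (t%:P - 'X) (t + e).
Proof.
split=> -[t t0 H]; last first.
  by exists t => [|x]; [exact: ltW|rewrite -horner_op_subX].
exists (t + 1) => [|x]; first by rewrite ltr_wpDl.
rewrite horner_op_subX rmorphD scalerDl addrAC (le_trans (pD _ _))//.
by rewrite addrAC mulrDl lerD// pZ normr1.
Qed.

Lemma cstar_lb_le a e d : e <= d -> cstar_lb a e -> cstar_lb a d.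
Proof.
move=> ed [t t0 H]; exists t => // x.
by rewrite (le_trans (H x))// ler_wpM2r ?lerD2l// cstar_ge0.
Qed.

Lemma cstar_lbD a b e d : cstar_lb a e -> cstar_lb b d -> cstar_lb (a + b) (e + d).
Proof.
move=> [t t0 ta] [s s0 sb]; exists (t + s) => [|x]; first exact: addr_ge0.
rewrite amulDl rmorphD scalerDl opprD addrACA (le_trans (pD _ _))//.
by rewrite addrACA mulrDl lerD.
Qed.

Lemma cstar_lbZ (r : R) a e : 0 <= r -> cstar_lb a e -> cstar_lb (r%:C *: a) (r * e).
Proof.
move=> r0 [t t0 ta]; exists (r * t) => [|x]; first exact: mulr_ge0.
rewrite amulZl rmorphM -scalerA -scalerBr pZ ger0_norm//.
by rewrite -mulrDr -mulrA ler_wpM2l.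
Qed.

Lemma cstar_lb_small a e : p a <= e -> cstar_lb a e.
Proof.
move=> ae; exists 0 => // x; rewrite scale0r sub0r cstarN// add0r.
by rewrite (le_trans (cstarM pC _ _))// ler_wpM2r// cstar_ge0.
Qed.

Lemma op_bound_amul a : op_bound p (amul a) 'X (p a).
Proof. by move=> x; rewrite horner_opX cstarM. Qed.

Lemma cstar_lb_sqr a e : star a = a -> 0 <= e -> cstar_lb (amul a a) e.
Proof.
move=> sa e0; apply: (@cstar_lb_le _ 0) => //.
have c1 : 0 < p a ^+ 2 + 1 by rewrite ltr_wpDl ?sqr_ge0.
exists (p a ^+ 2 + 1) => [|x]; first exact: ltW.
have X2 : op_bound p (amul a) ('X ^+ 2) (p a ^+ 2 + 1).
  apply: (op_bound_eq pD pZ (op_boundM (cstar_ge0 pC a) (op_bound_amul a) (op_bound_amul a))) => //.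
  by rewrite -expr2 lerDl.
have := op_pos_ball_ge pD pZ (fun f g r => @op_bound_cstar _ _ _ pC a f g r sa)
  c1 (op_pos_sqr _ pD pZ _) X2 x.
rewrite horner_opD horner_opC -mulN1r -polyC1 -polyCN horner_opM horner_opC.
by rewrite expr2 horner_opM !horner_opX /= rmorphN scaleN1r amulA addr0.
Qed.

(** [a + e] lies between 0 and [d + e], hence is bounded by [d + e]; shifting back costs another
    [e]. *)
Lemma cstar_lb_norm a e d : star a = a -> 0 <= e -> 0 <= d ->
  cstar_lb a e -> cstar_lb (- a) d -> p a <= d + 2 * e.
Proof.
move=> sa e0 d0 /cstar_lbP[t t0 ta] /cstar_lbP[s s0 sa'].
apply: (cstar_le_op pC) => [|x]; first by lra.
have te : 0 < t + e by rewrite ltr_wpDr.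
have sd : 0 < s + d by rewrite ltr_wpDr.
have bX : op_bound p (amul a) ('X + e%:P) (p a + e).
  apply: (op_bound_eq pD pZ (op_boundD pD (op_bound_amul a) (op_bound_const _ pZ e))) => //.
  by rewrite ger0_norm.
have pX : op_pos p (amul a) ('X + e%:P).
  by apply: (op_pos_ball pD pZ te); apply: (op_bound_eq pD pZ ta) => //; rewrite polyCD; ring.
have pY : op_pos p (amul a) ((d + e)%:P - ('X + e%:P)).
  apply: (op_pos_ball pD pZ sd) => y; have := sa' y.
  rewrite horner_op_subX /= amulNl opprK -[amul a y]horner_opX -(horner_opC (amul a)) -horner_opD.
  by congr (p (horner_op _ _ _) <= _); rewrite !polyCD; ring.
have := op_pos_interval pD pZ (fun f g r => @op_bound_cstar _ _ _ pC a f g r sa)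
  (addr_ge0 d0 e0) bX pX pY.
move=> H; rewrite -[amul a x]horner_opX.
apply: (op_bound_eq pD pZ (op_boundB pD pZ H (op_bound_const _ pZ e))); first by ring.
by rewrite ger0_norm//; lra.
Qed.

(** The witness of a lower bound can be exchanged for any [r >= p a]: [a + e] is positive and
    bounded by [r + e], so it lies in the ball of that radius around [r + e]. *)
Lemma cstar_lb_ball a e r : star a = a -> 0 < e -> p a <= r -> cstar_lb a e ->
  forall x, p (r%:C *: x - amul a x) <= (r + e) * p x.
Proof.
move=> sa e0 ac /cstar_lbP[t t0 ta] x.
have r0 : 0 <= r by rewrite (le_trans _ ac)// cstar_ge0.
have te : 0 < t + e by rewrite addr_gt0.
have ce : 0 < r + e by rewrite ltr_wpDl.
have bX : op_bound p (amul a) ('X + e%:P) (r + e).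
  apply: (op_bound_eq pD pZ (op_boundD pD (op_bound_amul a) (op_bound_const _ pZ e))) => //.
  by rewrite gtr0_norm// lerD2r.
have pX : op_pos p (amul a) ('X + e%:P).
  by apply: (op_pos_ball pD pZ te); apply: (op_bound_eq pD pZ ta) => //; rewrite polyCD; ring.
have := op_pos_ball_ge pD pZ (fun f g u => @op_bound_cstar _ _ _ pC a f g u sa) ce pX bX.
by rewrite polyCD opprD addrACA subrr addr0 => /(_ x); rewrite horner_op_subX.
Qed.

(* Were [b b^* >= 0] and [P = - b^* b >= 0] with [p P = al > 0], the identity
   [P (al + P) = - b^* (al - b b^* ) b] would bound [P (al + P)] by [al^2],
   hence [al + P] by [3^(1/2) al], whereas its norm is [2 al]. *)
Lemma cstar_lb_swap b e : 0 < e ->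
  cstar_lb (amul b (star b)) e -> cstar_lb (- amul (star b) b) e -> p b ^+ 2 <= 9 * e.
Proof.
move=> e0 lb1 lb2; set al := p b ^+ 2; have al0 : 0 <= al := sqr_ge0 _.
have pbb : p (amul b (star b)) = al by rewrite -{1}[b]starK cstar_sqr ?cstar_star.
have sbb : star (amul b (star b)) = amul b (star b) by rewrite starM starK.
have hb : forall x, p (al%:C *: x - amul (amul b (star b)) x) <= (al + e) * p x.
  by apply: (cstar_lb_ball sbb e0 _ lb1); rewrite pbb.
pose P := - amul (star b) b.
have sP : star P = P by rewrite /P raddfN/= starM starK.
have pP : p P = al by rewrite cstarN// cstar_sqr.
have PX : op_bound p (amul P) ('X * (al%:P + 'X)) (al * (al + e)).
  move=> x; rewrite horner_opM horner_opX horner_opD horner_opC horner_opX /=.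
  rewrite (_ : amul P _ = - amul (star b) (al%:C *: amul b x -
      amul (amul b (star b)) (amul b x))); last first.
    rewrite /P !amulNl; congr (- _).
    by rewrite linearB [RHS]linearB /= !amulZr !amulA.
  rewrite cstarN// (le_trans (cstarM pC _ _))// cstar_star//.
  have := hb (amul b x); have := cstarM pC b x; have := cstar_ge0 pC b.
  have := cstar_ge0 pC x; rewrite /al; move: (p b) (p x) (p (amul b x)) (p (_ - _)).
  move=> u v w z v0 u0 wuv zw.
  have : z <= (u ^+ 2 + e) * (u * v).
    by rewrite (le_trans zw)// ler_wpM2l// addr_ge0// ?sqr_ge0// ltW.
  by move=> /(ler_wpM2l u0); lra.
(* [(al + P)^2 = al^2 + al P + P (al + P)] is bounded by [al^2 + al^2 + al (al + e)]. *)
pose th := Num.sqrt (3 * al ^+ 2 + al * e).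
have th2 : th ^+ 2 = 3 * al ^+ 2 + al * e.
  by rewrite sqr_sqrtr// addr_ge0// mulr_ge0// ?sqr_ge0// ltW.
have th0 : 0 <= th by exact: sqrtr_ge0.
have th1 : al <= th.
  by rewrite -(@ler_pXn2r _ 2)// th2; nra.
have bth : op_bound p (amul P) (al%:P + 'X) th.
  apply: (@op_bound_cstar _ _ _ pC P _ 0) => //.
  apply: (op_bound_eq pD pZ (op_boundD pD (op_boundD pD (op_bound_const _ pZ (al ^+ 2))
    (op_boundZ pZ al (op_bound_amul P))) PX)).
    by rewrite polyC_exp; ring.
  by rewrite pP !ger0_norm ?sqr_ge0// th2; lra.
have lbP : cstar_lb (- P) (th - al).
  exists al => // x; have := bth x; rewrite horner_opD horner_opC horner_opX/=.
  by rewrite amulNl opprK [al + _]addrC subrK.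
have thal : 0 <= th - al by rewrite subr_ge0.
have := cstar_lb_norm sP (ltW e0) thal lb2 lbP.
(* Here [2 (al - e) <= th]; squaring leaves [al^2 <= 9 al e - 4 e^2], whence the constant 9. *)
rewrite pP => alth; have [|ale] := leP al e; first by lra.
have : (2 * (al - e)) ^+ 2 <= th ^+ 2.
  by rewrite ler_pXn2r// ?nnegrE; lra.
rewrite th2 => H; have : al * al <= al * (9 * e) by nra.
by rewrite ler_pM2l//; lra.
Qed.

End fukamiya.

(** * Positivity of [b^* b] *)

Section positivity.
Context (R : realType) (A : starAlgType R) (p : A -> R) (pC : cstar_seminorm p).
Implicit Types (a b c x y : A) (e d : R).

Let pD := cstarD pC.
Let pZ := cstarZ pC.

(* With [b = u + i v], [b^* b + b b^* = 2 (u^2 + v^2)]. *)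
Lemma cstar_lb_star_swap b e : 0 <= e ->
  cstar_lb p (- amul b (star b)) e -> cstar_lb p (amul (star b) b) e.
Proof.
move=> e0 lb.
pose u := b + star b; pose v := 'i *: (b - star b).
have su : star u = u by rewrite /u starD starK addrC.
have sv : star v = v.
  by rewrite /v starZ conjc_i starD raddfN /= starK scaleNr -scalerN opprB.
have := cstar_lbD pC (cstar_lbD pC (cstar_lb_sqr pC su (lexx 0)) (cstar_lb_sqr pC sv (lexx 0)))
  (cstar_lbZ pC (ler0n _ 2) lb).
move=> /(cstar_lbZ pC (r := 2^-1)); rewrite invr_ge0 => /(_ (ler0n _ 2)).
rewrite !addr0 add0r mulrA mulVf// mul1r; congr (cstar_lb p _ e).
apply: (scalerI (a := 2%:C)); first by rewrite eq_complex/= pnatr_eq0.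
rewrite scalerA -rmorphM mulfV// scale1r /u /v.
rewrite amulZl amulZr scalerA mulc_ii scaleN1r.
rewrite !amulDl !amulDr !amulNl !raddfN /= !(amulNl, raddfN) /=.
have two (x : A) : 2%:C *: x = x + x.
  by rewrite -{2 3}(scale1r x) -scalerDl; congr (_ *: _); rewrite -[RHS](rmorphD (real_complex R) 1 1).
have opp (x y : A) : x + y - (x - y) = y + y.
  by rewrite opprB addrC addrA subrK.
rewrite !two opprK [amul (star b) b + amul (star b) (star b)]addrC [- amul (star b) b + _]addrC.
rewrite ![_ + (amul (star b) (star b) + _)]addrACA -opprD opp.
by rewrite [X in X - _ = _]addrACA [X in X - _ = _]addrC addrK.
Qed.

(* Kaplansky's argument. For [h = b^* b], [K] approximates [|h|], [S ^+ 2]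
   approximates [K] and [G = K - 'X] approximates twice the negative part of
   [h]; then [q = G(h) b^*] satisfies [q q^* = h G(h)^2 ~ - (S G)(h)^2 <= 0], which
   forces [q] and then [G(h)] to be small. *)
Lemma cstar_lb_star_mul b e : 0 < e -> cstar_lb p (amul (star b) b) e.
Proof.
wlog b1 : b e / p b <= 1 => [H e0|].
  pose r := p b + 1; have r0 : 0 < r by rewrite ltr_wpDl// cstar_ge0.
  have := H ((r^-1)%:C *: b) (e / r ^+ 2).
  rewrite cstarZ// ger0_norm ?invr_ge0 ?(ltW r0)// [_^-1 * _]mulrC ler_pdivrMr// mul1r lerDl ler01.
  move=> /(_ isT) /(_ (divr_gt0 e0 (exprn_gt0 2 r0))).
  move=> /(cstar_lbZ pC (ltW (exprn_gt0 2 r0))).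
  rewrite mulrC divfK ?gt_eqF ?exprn_gt0//.
  rewrite starZ amulZl amulZr conjc_realE !scalerA -!rmorphM expr2 mulrA.
  by rewrite mulfK ?gt_eqF// mulfV ?gt_eqF// scale1r.
move=> e0; pose h := amul (star b) b.
have sh : star h = h by rewrite /h starM starK.
have bX : op_bound p (amul h) 'X 1.
  apply: (op_bound_le pD pZ _ (op_bound_amul pC h)).
  by rewrite cstar_sqr// expr_le1// cstar_ge0.
have bC f g r := @op_bound_cstar _ _ _ pC h f g r sh.
(* The losses are [3 d + 9 d = 12 d] in [bE], nine times that from [cstar_lb_swap], and
   [2 * 108 d * 3 + 9 d = 657 d] in [bG4], which has to be [e^4]. *)
pose d := e ^+ 4 / 657.
have d0 : 0 < d by rewrite divr_gt0// exprn_gt0.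
have bX2 : op_bound p (amul h) ('X ^+ 2) 1.
  by apply: (op_bound_eq pD pZ (op_boundM ler01 bX bX)); rewrite ?mulr1.
have bk := op_pos_ball_ge pD pZ bC ltr01 (op_pos_sqr _ pD pZ _) bX2.
have [Y [bY]] := op_bound_sqrt pD pZ bk d0.
pose K : {poly R} := 1 - Y; rewrite -/K => bK.
have KP : op_pos p (amul h) K.
  apply: (op_pos_ball pD pZ ltr01); apply: (op_bound_eq pD pZ bY) => //.
  by rewrite /K polyC1; ring.
have [S bS] := KP d d0.
pose G : {poly R} := K - 'X.
have bG : op_bound p (amul h) G 3.
  apply: (op_bound_eq pD pZ (op_boundB pD pZ (op_boundB pD pZ (op_bound1 _ pZ) bY) bX)) => //.
  by lra.
have bG2 : op_bound p (amul h) (G ^+ 2) 9.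
  by apply: (op_bound_eq pD pZ (op_boundM (ler0n _ 3) bG bG)) => //; lra.
pose q := horner_op (amul h) G (star b).
have qM x : amul (amul q (star q)) x = horner_op (amul h) ('X * G ^+ 2) x.
  rewrite -amulA (_ : amul (star q) x = amul b (horner_op (amul h) G x)); last first.
    by rewrite horner_amul_adj// starK.
  by rewrite -horner_amulMr amulA -/h -horner_opX -!horner_opM; congr horner_op; ring.
have bE : op_bound p (amul h) ('X * G ^+ 2 + (S * G) ^+ 2) (12 * d).
  apply: (op_bound_eq pD pZ (op_boundB pD pZ (op_boundN pD pZ (op_boundM (ltW d0) bK bG))
    (op_boundM (ltW d0) bS bG2))); last by lra.
  by rewrite /G polyC1; ring.
have ed0 : 0 <= 12 * d by rewrite mulr_ge0// ltW.
have lbN : cstar_lb p (- amul q (star q)) (12 * d).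
  have bSG : op_bound p (amul h) ((S * G) ^+ 2) (9 + 12 * d).
    apply: (op_bound_eq pD pZ (op_boundB pD pZ bE (op_boundM ler01 bX bG2))); first by ring.
    by lra.
  have t0 : 0 < 9 + 12 * d by lra.
  exists (9 + 12 * d) => [|x]; first exact: ltW.
  rewrite amulNl opprK qM -(horner_opC (amul h)) -horner_opD.
  have := op_pos_ball_ge pD pZ bC t0 (op_pos_sqr _ pD pZ _) bSG.
  move=> /(fun u => op_boundD pD u bE) /(op_bound_eq pD pZ); apply => //; ring.
have lbP := cstar_lb_star_swap ed0 lbN.
have qq : p (amul q (star q)) <= 108 * d.
  have e'0 : 0 < 12 * d by rewrite mulr_gt0.
  have := @cstar_lb_swap _ _ _ pC (star q) _ e'0.
  rewrite starK => /(_ lbP lbN); rewrite -cstar_sqr// starK; lra.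
have bXG : op_bound p (amul h) ('X * G ^+ 2) (108 * d).
  by move=> x; rewrite -qM (le_trans (cstarM pC _ _))// ler_wpM2r// cstar_ge0.
(* From [G = K - 'X] and [K^2 ~ 'X^2] one gets [G^2 ~ - 2 'X G], so [G^4 ~ - 2 ('X G^2) G] is small;
   two uses of [bC] with second square 0 then extract the fourth root. *)
have bG4 : op_bound p (amul h) (G ^+ 2 ^+ 2 + 0 ^+ 2) (e ^+ 2 ^+ 2).
  apply: (op_bound_eq pD pZ (op_boundB pD pZ
    (op_boundZ pZ (-2) (op_boundM _ bXG bG)) (op_boundM (ltW d0) bK bG2))).
  - by rewrite mulr_ge0// ltW.
  - by rewrite /G polyCN polyC1 (_ : 2%:P = 2 :> {poly R}) ?polyC_natr//; ring.
  - by rewrite normrN ger0_norm// /d -exprM; lra.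
have bGe : op_bound p (amul h) G e.
  apply: (bC _ 0) => //; first exact: ltW.
  apply: (op_bound_eq pD pZ (bC _ _ _ (sqr_ge0 e) bG4)) => //.
  by rewrite expr0n addr0.
exists 1 => // x; rewrite -horner_op_subX.
apply: (op_bound_eq pD pZ (op_boundD pD bY bGe)) => //.
by rewrite /G /K polyC1; ring.
Qed.
End positivity.

Section positive_elements.
Context (R : realType) (A : starAlgType R) (p : A -> R) (pC : cstar_seminorm p).
Implicit Types (a b : A) (e : R).

Definition cstar_pos a := forall e, 0 < e -> cstar_lb p a e.

Lemma positive_cstar_pos a : positive a -> cstar_pos a.
Proof. by move=> [b ->] e e0; exact: cstar_lb_star_mul. Qed.

Lemma cstar_posD a b : cstar_pos a -> cstar_pos b -> cstar_pos (a + b).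
Proof.
move=> a0 b0 e e0; rewrite (splitr e).
by apply: cstar_lbD => //; [exact: a0 (divr_gt0 _ _)|exact: b0 (divr_gt0 _ _)].
Qed.

(** [- a = b - (a + b)] is bounded below by [- p (a + b) - e / 3], and [a] by [- e / 3]; in
    [cstar_lb_norm] the errors add up to [e]. *)
Lemma cstar_pos_le a b : star a = a -> cstar_pos a -> cstar_pos b -> p a <= p (a + b).
Proof.
move=> sa a0 b0; apply/ler_addgt0Pr => e e0.
have e30 : 0 < e / 3 by rewrite divr_gt0.
have := cstar_lbD pC (b0 _ e30) (cstar_lb_small pC (a := - (a + b)) (lexx _)).
rewrite opprD addrCA subrr addr0 -opprD cstarN// => lb.
have := cstar_lb_norm pC sa (ltW e30) _ (a0 _ e30) lb.
by rewrite addr_ge0 ?(ltW e30) ?cstar_ge0// => /(_ isT); lra.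
Qed.

End positive_elements.

(** * Inner products and the Cauchy-Schwarz inequality *)

Section inner_product.
Context (R : realType) (A : locallyCstarType R) (E : preHilbertModType A).
Implicit Types (x y z : E) (a : A).

Let inner_linear x : linear (inner x).
Proof. by move=> k y z; rewrite innerDr innerZr. Qed.

HB.instance Definition _ x :=
  GRing.isLinear.Build R[i] E A _ (inner x) (inner_linear x).

Lemma innerDl x y z : inner (x + y) z = inner x z + inner y z.
Proof. by rewrite -inner_star innerDr starD !inner_star. Qed.

Lemma innerZl (k : R[i]) x y : inner (k *: x) y = k^* *: inner x y.
Proof. by rewrite -inner_star innerZr starZ inner_star. Qed.

Lemma innerZlr (r : R) x y : inner (r%:C *: x) y = r%:C *: inner x y.
Proof. by rewrite innerZl conjc_realE. Qed.

Lemma innerNl x y : inner (- x) y = - inner x y.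
Proof. by rewrite -inner_star raddfN /= raddfN /= inner_star. Qed.

Lemma innerBl x y z : inner (x - y) z = inner x z - inner y z.
Proof. by rewrite innerDl innerNl. Qed.

Lemma inner_ractl x y a : inner (ract x a) y = amul (star a) (inner x y).
Proof. by rewrite -inner_star inner_ract starM inner_star. Qed.

Section seminorm.
Context (p : A -> R) (pC : cstar_seminorm p).
Local Notation nu := (@hseminorm R A E p).

Lemma inner_pos x : cstar_pos p (inner x x).
Proof. by apply: (positive_cstar_pos pC); exact: inner_positive. Qed.

Lemma inner_le x a : cstar_pos p a -> p (inner x x) <= p (inner x x + a).
Proof. by move=> a0; apply: cstar_pos_le => //; [rewrite inner_star|exact: inner_pos]. Qed.

(** Expanding [<z, z>] for [z = x a - y] gives [<y, y> = a^* a + <z, z> + (a^* a - a^* h a)]. The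
    last bracket is positive as [h] is bounded by 1: up to a small error it is [s^* s], with [s]
    obtained from an approximate root of [1 - h]. *)
Let cauchy_schwarz1 x y : p (inner x x) <= 1 -> p (inner x y) ^+ 2 <= p (inner y y).
Proof.
move=> x1; set a := inner x y; pose h := inner x x.
have sh : star h = h by rewrite inner_star.
pose z := ract x a - y.
have zz : inner z z = amul (star a) (amul h a) - amul (star a) a - amul (star a) a + inner y y.
  rewrite /z innerBl !linearB /= !inner_ractl !inner_ract -/a.
  by rewrite -[inner y x]inner_star -/a opprK addrA.
pose b := inner z z + (amul (star a) a - amul (star a) (amul h a)).
have -> : inner y y = amul (star a) a + b.
  rewrite /b zz; move: (amul _ a) (amul _ (amul h a)) (inner y y) => u v w.
  by rewrite [_ + w + _]addrAC [v - u - u + _]addrA subrK [v - u - v]addrAC subrr add0r addrA subrr add0r.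
rewrite -cstar_sqr//; apply: cstar_pos_le => //.
- by rewrite starM starK.
- by apply: positive_cstar_pos => //; exists a.
apply: cstar_posD => //; first exact: inner_pos.
move=> e e0.
have a1 : 0 < p a ^+ 2 + 1 by rewrite ltr_wpDl ?sqr_ge0.
have bX : op_bound p (amul h) 'X 1.
  exact: (op_bound_le (cstarD pC) (cstarZ pC) x1 (op_bound_amul pC h)).
have e'0 : 0 < e / 2 / (p a ^+ 2 + 1) by rewrite !divr_gt0.
have [Y [_ bY]] := op_bound_sqrt (cstarD pC) (cstarZ pC) bX e'0.
pose S : {poly R} := 1 - Y; rewrite -/S in bY.
pose s := horner_op (amul h) S a.
pose t := horner_op (amul h) (1 - 'X - S ^+ 2) a.
have -> : amul (star a) a - amul (star a) (amul h a) =
    amul (star s) s + amul (star a) t.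
  rewrite /s horner_amul_adj// -horner_opM -expr2 -amulDr -horner_opD.
  rewrite addrCA subrr addr0 -linearB /= -polyC1 horner_op_subX scale1r.
  by [].
rewrite (splitr e); apply: cstar_lbD => //.
  by apply: cstar_lb_star_mul => //; rewrite divr_gt0.
apply: cstar_lb_small => //; rewrite (le_trans (cstarM pC _ _))// cstar_star//.
have := bY a; rewrite -/t => ta; have pa := cstar_ge0 pC a.
rewrite (le_trans (ler_wpM2l pa ta))// mulrCA -expr2 mulrAC ler_pdivrMr//.
by rewrite ler_pM2l ?divr_gt0// lerDl.
Qed.

Lemma cauchy_schwarz x y : p (inner x y) ^+ 2 <= p (inner x x) * p (inner y y).
Proof.
apply/ler_addgt0Pr => e e0; have y0 := cstar_ge0 pC (inner y y).
have x0 := cstar_ge0 pC (inner x x).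
have y1 : 0 < p (inner y y) + 1 by rewrite ltr_wpDl.
(* The extra term makes [c] positive even if [p (inner x x) = 0], and contributes at most [e] after
   multiplication by [p (inner y y)]. *)
pose c := p (inner x x) + e / (p (inner y y) + 1).
have c0 : 0 < c by rewrite ltr_wpDl// divr_gt0.
have sc0 : 0 < Num.sqrt c by rewrite sqrtr_gt0.
have := @cauchy_schwarz1 ((Num.sqrt c)^-1%:C *: x) y.
rewrite !innerZlr innerZr scalerA -rmorphM !cstarZ// normrM gtr0_norm ?invr_gt0//.
rewrite -expr2 exprVn sqr_sqrtr ?(ltW c0)// mulrC ler_pdivrMr// mul1r.
rewrite /c lerDl divr_ge0 ?(ltW e0) ?(ltW y1)// => /(_ isT).
rewrite -/c exprMn exprVn sqr_sqrtr ?(ltW c0)// mulrC ler_pdivrMr// => /le_trans; apply.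
rewrite /c mulrDr mulrC lerD2l mulrCA ger_pMr// ler_pdivrMr// mul1r lerDl//.
Qed.

Lemma hseminorm_ge0 x : 0 <= nu x.
Proof. exact: sqrtr_ge0. Qed.

Lemma hseminorm_sqr x : nu x ^+ 2 = p (inner x x).
Proof. by rewrite sqr_sqrtr// cstar_ge0. Qed.

Lemma hseminorm_le x (c : R) : 0 <= c -> (nu x <= c) = (p (inner x x) <= c ^+ 2).
Proof. by move=> c0; rewrite -hseminorm_sqr ler_pXn2r// ?nnegrE ?hseminorm_ge0. Qed.

Lemma inner_hseminorm x y : p (inner x y) <= nu x * nu y.
Proof.
rewrite -(@ler_pXn2r _ 2)// ?nnegrE ?mulr_ge0 ?hseminorm_ge0 ?cstar_ge0//.
by rewrite exprMn !hseminorm_sqr cauchy_schwarz.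
Qed.

Lemma hseminormD x y : nu (x + y) <= nu x + nu y.
Proof.
rewrite hseminorm_le ?addr_ge0 ?hseminorm_ge0// innerDl !linearD /=.
rewrite (le_trans (cstarD pC _ _))// (le_trans (lerD (cstarD pC _ _) (cstarD pC _ _)))//.
rewrite -!hseminorm_sqr.
have := inner_hseminorm x y; have := inner_hseminorm y x; lra.
Qed.

Lemma hseminormZ (r : R) x : nu (r%:C *: x) = `|r| * nu x.
Proof.
rewrite /hseminorm innerZlr innerZr scalerA -rmorphM cstarZ// normrM -expr2.
by rewrite sqrtrM ?sqr_ge0// sqrtr_sqr normr_id.
Qed.

Lemma hseminormN x : nu (- x) = nu x.
Proof. by rewrite /hseminorm innerNl raddfN /= opprK. Qed.

Lemma hseminormB x y : nu (x - y) = nu (y - x).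
Proof. by rewrite -hseminormN opprB. Qed.

Lemma hseminorm0 : nu 0 = 0.
Proof. by rewrite /hseminorm linear0 cstar0// sqrtr0. Qed.

End seminorm.
End inner_product.

(** * Separation and completeness *)

Section locally_cstar.
Context (R : realType) (A : locallyCstarType R).
Local Notation S := (@continuous_cstar_seminorms R A).

Lemma continuous_cstar_seminorm0 : S (cst 0).
Proof.
split; last exact: cst_continuous.
by split=> *; rewrite ?addr0 ?mulr0 ?expr0n.
Qed.

Lemma continuous_cstar_seminorm_max (p q : A -> R) :
  S p -> S q -> S (p \max q).
Proof.
move=> [pC pcont] [qC qcont]; split; last first.
  by move=> x; exact: continuous_max (pcont x) (qcont x).
have p0 := cstar_ge0 pC; have q0 := cstar_ge0 qC.
have pm a : p a <= Num.max (p a) (q a) by rewrite le_max lexx.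
have qm a : q a <= Num.max (p a) (q a) by rewrite le_max lexx orbT.
split=> [a b|k a|a b|a] /=.
- by rewrite ge_max (le_trans (cstarD pC _ _) (lerD _ _))//
    (le_trans (cstarD qC _ _) (lerD _ _)).
- case: pC qC => _ -> _ _ [_ -> _ _]; rewrite maxr_pMr//.
  by case: k => *; rewrite sqrtr_ge0.
- by rewrite ge_max (le_trans (cstarM pC _ _) (ler_pM _ _ _ _))//
    (le_trans (cstarM qC _ _) (ler_pM _ _ _ _)).
- rewrite !cstar_sqr//; have [pq|/ltW pq] := leP (p a) (q a).
    by rewrite max_r// ler_pXn2r// nnegrE.
  by rewrite max_l// ler_pXn2r// nnegrE.
Qed.

(** When all seminorms vanish at [a], the principal filter at [a] converges to 0, and the space is
    Hausdorff. *)
Lemma locally_cstar_eq0 (a : A) : (forall p, S p -> p a = 0) -> a = 0.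
Proof.
move=> pa; pose F : set_system A := [set U | U a].
have FF : ProperFilter F.
  by split=> //; split=> // P Q PQ; exact: PQ.
have F0 : F --> (0 : A).
  apply/cvg0_cstar_seminormsP => p Sp U U0.
  by change (U (p a)); rewrite pa//; exact: nbhs_singleton.
apply: (@locally_cstar_hausdorff R A) => U V Ua V0.
by exists a; split; [exact: nbhs_singleton|exact: (F0 V V0)].
Qed.

End locally_cstar.

Section hilbert_module.
Context (R : realType) (A : locallyCstarType R).
Local Notation S := (@continuous_cstar_seminorms R A).

Lemma hseminorm_eq0 (E : preHilbertModType A) (x : E) :
  (forall p, S p -> hseminorm p x = 0) -> x = 0.
Proof.
move=> x0; apply/inner_eq0/locally_cstar_eq0 => p Sp.
by rewrite -hseminorm_sqr ?x0 ?expr0n//; case: Sp.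
Qed.

Lemma hseminorm_le_max (E : preHilbertModType A) (p q : A -> R) (x : E) :
  hseminorm p x <= hseminorm (p \max q) x.
Proof. by rewrite ler_wsqrtr// le_max lexx. Qed.

Lemma hseminorm_le_maxr (E : preHilbertModType A) (p q : A -> R) (x : E) :
  hseminorm q x <= hseminorm (p \max q) x.
Proof. by rewrite ler_wsqrtr// le_max lexx orbT. Qed.

Context (E : hilbertModType A).

Lemma nbhs_hseminorm (x : E) p e : S p -> 0 < e ->
  nbhs x [set y : E | hseminorm p (x - y) < e].
Proof.
move=> Sp e0.
have V : entourage [set xy : E * E | hseminorm p (xy.1 - xy.2) < e].
  by rewrite hilbert_entourageE; exists (p, e).
by apply: filterS (nbhs_entourage x V) => y /xsectionP.
Qed.

Lemma dense_hseminorm (B : set E) : dense B ->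
  forall x p e, S p -> 0 < e -> exists2 y, B y & hseminorm p (x - y) < e.
Proof.
move=> dB x p e Sp e0; have nx := nbhs_hseminorm x Sp e0.
have [||y [/interior_subset xy By]] := dB (interior [set y : E | hseminorm p (x - y) < e]).
- by exists x.
- exact: open_interior.
- by exists y.
Qed.

(** Completeness without filters, used for every limit below. The approximating sets are indexed by
    a seminorm and a tolerance because the topology need not be metrizable. *)
Lemma hilbert_completeP (D : (A -> R) -> R -> set E) :
  (forall p e, S p -> 0 < e -> D p e !=set0) ->
  (forall p q e d, S p -> S q -> 0 < e -> 0 < d ->
     D (p \max q) (Num.min e d) `<=` D p e `&` D q d) ->
  (forall p e x y, S p -> 0 < e -> D p e x -> D p e y ->
     hseminorm p (x - y) <= 2 * e) ->
  exists l, forall p e, S p -> 0 < e -> exists2 x, D p e x & hseminorm p (l - x) < e.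
Proof.
move=> D0 DI Dd.
pose F : set_system E := filter_from
  [set pe : (A -> R) * R | S pe.1 /\ 0 < pe.2] (fun pe => D pe.1 pe.2).
have FF : ProperFilter F.
  apply: filter_from_proper; last by move=> [p e] [/=]; exact: D0.
  apply: filter_from_filter.
    by exists (cst 0, 1); split=> //; exact: continuous_cstar_seminorm0.
  move=> [p e] [q d] [/= Sp e0] [/= Sq d0]; exists (p \max q, Num.min e d).
    by split; [exact: continuous_cstar_seminorm_max|rewrite /= lt_min e0].
  exact: DI.
have Fc : cauchy F.
  move=> V; rewrite hilbert_entourageE => -[[p e] [/= Sp e0] pV].
  have e30 : 0 < e / 3 by rewrite divr_gt0.
  exists (D p (e / 3), D p (e / 3)); first by split; exists (p, e / 3).
  move=> [x y] [/= Dx Dy]; apply: pV => /=.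
  by rewrite (le_lt_trans (Dd _ _ _ _ Sp e30 Dx Dy))//; lra.
have [l Fl] := hilbert_complete F FF Fc; exists l => p e Sp e0.
have FD : F (D p e) by exists (p, e).
by have [x [lx Dx]] := filter_ex (filterI (Fl _ (nbhs_hseminorm l Sp e0)) FD); exists x.
Qed.

End hilbert_module.

Section function_with_adjoint.
Context (R : realType) (A : locallyCstarType R) (E F : preHilbertModType A).
Context (f : E -> F) (g : F -> E).
Hypothesis fg : forall x y, inner (f x) y = inner x (g y).

Let gf y x : inner y (f x) = inner (g y) x.
Proof. by rewrite -inner_star fg inner_star. Qed.

Let f_linear : linear f.
Proof.
by move=> k x y; apply: inner_inj => z; rewrite innerDr innerZr !gf innerDr innerZr.
Qed.

Let f_ract x a : f (ract x a) = ract (f x) a.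
Proof. by apply: inner_inj => z; rewrite inner_ract !gf inner_ract. Qed.

Let f_linearType : {linear E -> F} :=
  HB.pack f (GRing.isLinear.Build R[i] E F _ f f_linear).

(** Since the inner product separates points, an adjoint forces linearity over the scalars and over
    [A]; maps obtained by choice thus become operators from the pairing identity alone. *)
Definition adjointable_of : adjointable E F :=
  @Adjointable R A E F f_linearType f_ract g fg.

End function_with_adjoint.

(** * Adjointable contractions *)

Section bounded_operators.
Context (R : realType) (A : locallyCstarType R).
Context (p : A -> R) (pC : cstar_seminorm p).
Implicit Types (E F : preHilbertModType A).
Local Notation nu := (hseminorm p).

Lemma adj_op E F (T : adjointable E F) y x : inner (adj T y) x = inner y (T x).
Proof. by rewrite -inner_star -adjP inner_star. Qed.

Lemma adj_bound E F (T : adjointable E F) c : 0 <= c ->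
  (forall x, nu (T x) <= c * nu x) -> forall y, nu (adj T y) <= c * nu y.
Proof.
move=> c0 Tc y; have := hseminorm_ge0 p (adj T y).
rewrite le_eqVlt => /predU1P[<-|Ty0]; first by rewrite mulr_ge0// hseminorm_ge0.
rewrite -(ler_pM2r Ty0) -expr2 hseminorm_sqr// adj_op.
by rewrite (le_trans (inner_hseminorm pC _ _))// -mulrA mulrCA ler_wpM2l ?hseminorm_ge0.
Qed.

(* If [s] approximates [(1 - T^* T)^(1/2)], then [<s y, s y> + <T y, T y>] is
   close to [<y, y>], so that [s] is nearly a contraction. *)
Lemma contraction_sub E F (T : adjointable E F) :
  (forall x, nu (T x) <= nu x) -> forall x, nu (x - adj T (T x)) <= nu x.
Proof.
move=> Tc x; apply/ler_addgt0Pr => e e0.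
have nD := @hseminormD _ _ E p pC; have nZ := @hseminormZ _ _ E p pC.
pose S : {linear E -> E} := adj T \o T.
have S1 : op_bound nu S 'X 1.
  move=> y; rewrite horner_opX mul1r /= (le_trans _ (Tc _))// -[leRHS]mul1r.
  by apply: adj_bound => // z; rewrite mul1r.
have x0 := hseminorm_ge0 p x; have x1 : 0 < nu x + 1 by rewrite ltr_wpDl.
(* The final estimate is [(d + (1 + d)^2) nu x <= (1 + 4 d) nu x], using [d <= 1]. *)
pose d := Num.min 1 (e / (4 * (nu x + 1))).
have d0 : 0 < d by rewrite lt_min ltr01 divr_gt0// mulr_gt0.
have [Y [_]] := op_bound_sqrt nD nZ S1 d0.
pose s : {poly R} := 1 - Y; rewrite -/s => bs.
have s1 y : nu (horner_op S s y) <= (1 + d) * nu y.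
  have d1 : 0 <= 1 + d by rewrite addr_ge0// ltW.
  have errE : horner_op S (1 - 'X - s ^+ 2) y = y - S y - horner_op S (s ^+ 2) y.
    have := horner_op_subX S 1 y; rewrite scale1r polyC1 => <-.
    by apply: (addIr (horner_op S (s ^+ 2) y)); rewrite -horner_opD !subrK.
  have sTE : inner (horner_op S s y) (horner_op S s y) + inner (T y) (T y) =
      inner y y - inner y (horner_op S (1 - 'X - s ^+ 2) y).
    rewrite (@horner_op_adj _ _ _ S (@inner R A E)); first last.
    - by move=> u v; rewrite /= adj_op adjP.
    - by move=> a u v; rewrite innerZr.
    - by move=> a u v; rewrite innerZlr.
    - by move=> u v w; rewrite innerDr.
    - by move=> u v w; rewrite innerDl.
    rewrite -horner_opM -expr2 adjP -linearB -linearD /=; congr inner.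
    by rewrite errE opprB [RHS]addrCA opprB [y + _]addrC subrK.
  rewrite hseminorm_le ?mulr_ge0 ?hseminorm_ge0//.
  rewrite (le_trans (inner_le pC _ (inner_pos pC (T y))))// sTE.
  rewrite (le_trans (cstarD pC _ _))// cstarN// -hseminorm_sqr//.
  have := inner_hseminorm pC y (horner_op S (1 - 'X - s ^+ 2) y).
  have := bs y; have := hseminorm_ge0 p y.
  move: (nu (horner_op S (1 - 'X - s ^+ 2) y)) (nu y) (p _) => v u w u0 vu wuv.
  have : u * v <= u * (d * u) by rewrite ler_wpM2l.
  have : 0 <= d * u ^+ 2 by rewrite mulr_ge0 ?sqr_ge0// ltW.
  have : 0 <= d ^+ 2 * u ^+ 2 by rewrite mulr_ge0 ?sqr_ge0.
  by rewrite exprMn; lra.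
have -> : x - adj T (T x) = horner_op S (1 - 'X - s ^+ 2) x + horner_op S s (horner_op S s x).
  rewrite -horner_opM -expr2 -horner_opD subrK.
  by have := horner_op_subX S 1 x; rewrite scale1r polyC1 => ->.
rewrite (le_trans (nD _ _))// (le_trans (lerD (bs x) (s1 _)))//.
have := s1 x; have d1 : d <= 1 by rewrite ge_min lexx.
have : d * (4 * (nu x + 1)) <= e.
  by rewrite -ler_pdivlMr ?mulr_gt0// ge_min lexx orbT.
have := hseminorm_ge0 p (horner_op S s x).
move: (nu _) (nu x) x0 => v u u0 v0 due vdu.
have : (1 + d) * v <= (1 + d) * ((1 + d) * u).
  by rewrite ler_wpM2l// addr_ge0// ltW.
have : 0 <= d * u * (1 - d) by rewrite !mulr_ge0 ?subr_ge0// ltW.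
by move: due d0; lra.
Qed.

End bounded_operators.

(** * Inverting [1 + H] for a positive operator [H] *)

Section resolvent.
Context (R : realType) (A : locallyCstarType R).
Local Notation S := (@continuous_cstar_seminorms R A).

Lemma square_sub_bound (p : A -> R) (E F : preHilbertModType A)
    (T : adjointable E F) (c : R) :
  cstar_seminorm p -> 0 < c -> (forall x, hseminorm p (T x) <= c * hseminorm p x) ->
  forall x, hseminorm p ((c ^+ 2)%:C *: x - adj T (T x)) <= c ^+ 2 * hseminorm p x.
Proof.
move=> pC c0 Tc x.
have fg y z : inner ((c^-1)%:C *: T y) z = inner y ((c^-1)%:C *: adj T z).
  by rewrite innerZlr innerZr adjP.
have := @contraction_sub _ _ _ pC _ _ (adjointable_of fg) _ x.
have T1 y : hseminorm p (adjointable_of fg y) <= hseminorm p y.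
  by rewrite hseminormZ// gtr0_norm ?invr_gt0// mulrC ler_pdivrMr// mulrC.
move=> /(_ T1) /= H; rewrite -(ler_pM2l (exprn_gt0 2 c0)) in H.
apply: le_trans H; rewrite -{2}(gtr0_norm (exprn_gt0 2 c0)) -hseminormZ//.
have -> : adj T ((c^-1)%:C *: T x) = (c^-1)%:C *: adj T (T x) by rewrite linearZ.
rewrite [leRHS](_ : _ = hseminorm p ((c ^+ 2)%:C *: x - adj T (T x)))//.
congr (hseminorm p _); rewrite scalerBr; congr (_ - _).
rewrite !scalerA -!rmorphM /= -[RHS]scale1r; congr (_%:C *: _).
by rewrite -invfM -expr2 divff// gt_eqF// exprn_gt0.
Qed.

Section seminorm.
Context (p : A -> R) (pC : cstar_seminorm p) (E : preHilbertModType A).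
Context (H : {linear E -> E}) (t : R).
Hypotheses (t0 : 0 <= t)
  (Ht : forall x : E, hseminorm p (t%:C *: x - H x) <= t * hseminorm p x).
Local Notation nu := (hseminorm p).

(** Split [(1 + t) x = (x + H x) + (t x - H x)]; the second term costs at most [t * nu x]. *)
Lemma resolvent_lower_bound (x : E) : nu x <= nu (x + H x).
Proof.
have := hseminormD pC (x + H x) (t%:C *: x - H x).
rewrite addrACA subrr addr0 -{1}[x]scale1r -(rmorph1 (real_complex R)) -scalerDl.
rewrite -rmorphD /= hseminormZ// ger0_norm ?addr_ge0//.
by have := Ht x; lra.
Qed.

(** Correcting [x] by [(1 + t)^-1] times the residual shrinks the residual by the factor
    [t / (1 + t) < 1]. *)
Lemma resolvent_approx (d : E) e : 0 < e -> exists x, nu (d - (x + H x)) < e.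
Proof.
move=> e0; pose q := t / (1 + t).
have t1 : 0 < 1 + t by rewrite ltr_wpDr.
have q0 : 0 <= q by rewrite divr_ge0// ltW.
have q1 : q < 1 by rewrite ltr_pdivrMr// mul1r ltrDr.
have step n : exists x, nu (d - (x + H x)) <= q ^+ n * nu d.
  elim: n => [|n [x IH]].
    by exists 0; rewrite linear0 addr0 subr0 expr0 mul1r.
  pose r := d - (x + H x); exists (x + (1 + t)^-1%:C *: r).
  have -> : d - (x + (1 + t)^-1%:C *: r + H (x + (1 + t)^-1%:C *: r)) =
      (1 + t)^-1%:C *: (t%:C *: r - H r).
    have rE : r = (1 + t)^-1%:C *: ((1 + t)%:C *: r).
      by rewrite scalerA -rmorphM mulVf ?gt_eqF// scale1r.
    have -> : H (x + (1 + t)^-1%:C *: r) = H x + (1 + t)^-1%:C *: H r.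
      by rewrite linearD; congr (_ + _); rewrite linearZ.
    rewrite addrACA opprD addrA -/r -scalerDr {1}rE -scalerBr; congr (_ *: _).
    by rewrite rmorphD scalerDl scale1r opprD addrACA subrr add0r.
  rewrite hseminormZ// gtr0_norm ?invr_gt0// exprS mulrC ler_pdivrMr//.
  rewrite (le_trans (Ht r))// [q * _]mulrC -!mulrA [in leRHS]mulrC -!mulrA.
  rewrite /q mulrA [X in t * _ <= X](_ : _ = t * (q ^+ n * nu d)); last first.
    by rewrite /q; field; rewrite gt_eqF.
  by rewrite ler_wpM2l.
have [n qn] : exists n, q ^+ n * nu d < e.
  have /cvgrPdist_lt : (fun n => q ^+ n) @ \oo --> (0 : R).
    by apply: cvg_expr; rewrite ger0_norm.
  have d1 : 0 < nu d + 1 by rewrite ltr_wpDl// hseminorm_ge0.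
  move=> /(_ (e / (nu d + 1)) (divr_gt0 e0 d1)) /filter_ex [n].
  rewrite sub0r normrN ger0_norm ?exprn_ge0// ltr_pdivlMr// => /le_lt_trans qe.
  by exists n; apply: qe; rewrite ler_wpM2l ?exprn_ge0// lerDl.
by have [x xn] := step n; exists x; exact: le_lt_trans qn.
Qed.

End seminorm.

(** The iteration depends on the seminorm through [t]. By the lower bound, approximate solutions for
    [p] are close to each other for [p], so completeness yields a common exact solution. *)
Lemma resolvent_surjective (E : hilbertModType A) (H : {linear E -> E}) :
  (forall p, S p -> exists2 t, 0 <= t &
     forall x : E, hseminorm p (t%:C *: x - H x) <= t * hseminorm p x) ->
  forall d : E, exists x, x + H x = d.
Proof.
move=> Hb d.
have [|||x xP] := @hilbert_completeP R A E
    (fun p e => [set x | hseminorm p (d - (x + H x)) < e]).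
- move=> p e Sp e0; have [t t0 Ht] := Hb p Sp.
  by have [x xe] := resolvent_approx (proj1 Sp) t0 Ht d e0; exists x.
- move=> p q e r Sp Sq e0 r0 x /=; rewrite lt_min => /andP[xe xr]; split.
    exact: le_lt_trans (hseminorm_le_max _ _ _) xe.
  exact: le_lt_trans (hseminorm_le_maxr _ _ _) xr.
- move=> p e x y Sp e0 /= xe ye; have [t t0 Ht] := Hb p Sp; case: Sp => pC _.
  rewrite (le_trans (resolvent_lower_bound pC t0 Ht _))//.
  rewrite linearB /= addrACA -opprD -(subrK d (x + H x)) -addrA.
  rewrite (le_trans (hseminormD pC _ _))// hseminormB//.
  by move: xe ye; lra.
exists x; apply/esym/subr0_eq; apply: hseminorm_eq0 => p Sp.
have [t t0 Ht] := Hb p Sp; have pC := proj1 Sp.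
apply/le_anti; rewrite hseminorm_ge0 andbT; apply/ler_addgt0Pr => e e0; rewrite add0r.
have c0 : 0 < 2 + 2 * t by rewrite ltr_wpDr// mulr_ge0.
have [y ye xy] := xP p _ Sp (divr_gt0 e0 c0).
have Hxy : hseminorm p (H (x - y)) <= 2 * t * hseminorm p (x - y).
  have := hseminormD pC (t%:C *: (x - y)) (- (t%:C *: (x - y) - H (x - y))).
  rewrite opprB addrC subrK hseminormB// hseminormZ// ger0_norm//.
  by have := Ht (x - y); rewrite hseminormB//; lra.
have -> : d - (x + H x) = d - (y + H y) - ((x - y) + H (x - y)).
  rewrite linearB /= [x - y + _]addrACA -opprD opprB addrA subrK.
  by [].
rewrite (le_trans (hseminormD pC _ _))// hseminormN//.
rewrite (le_trans (lerD (ltW ye) (hseminormD pC _ _)))//.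
have eE : e / (2 + 2 * t) * (2 + 2 * t) = e by rewrite divfK ?gt_eqF.
move: (ltW xy) Hxy eE; move: (e / _) => k uk uH eE.
have : t * hseminorm p (x - y) <= t * k by rewrite ler_wpM2l.
by move: uH uk eE; lra.
Qed.

End resolvent.

(** * Vectors bounded uniformly in all seminorms *)

Section truncation.
Context (R : realType) (A : locallyCstarType R).
Local Notation S := (@continuous_cstar_seminorms R A).

Lemma cstar_pos_ball (p : A -> R) (a : A) : cstar_seminorm p ->
  star a = a -> cstar_pos p a ->
  forall x, p ((p a)%:C *: x - amul a x) <= p a * p x.
Proof.
move=> pC sa a0 x.
have -> : (p a)%:C *: x - amul a x = horner_op (amul a) ((p a)%:P - 'X) x.
  by rewrite horner_op_subX.
move: x; apply: (op_bound_lim (cstarD pC) (cstarZ pC)) => e e0 x.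
by rewrite horner_op_subX; exact: (cstar_lb_ball pC sa e0 (lexx _) (a0 e e0)).
Qed.

Lemma cstar_pos_resolvent_inj (a z : A) :
  star a = a -> (forall p, S p -> cstar_pos p a) -> z + amul a z = 0 -> z = 0.
Proof.
move=> sa a0 z0; apply: locally_cstar_eq0 => p Sp; have pC := proj1 Sp.
have := cstar_pos_ball pC sa (a0 p Sp) z.
have := cstarD pC (z + amul a z) ((p a)%:C *: z - amul a z).
rewrite addrACA subrr addr0 z0 cstar0// -{1}[z]scale1r -(rmorph1 (real_complex R)).
rewrite -scalerDl -rmorphD /= cstarZ// ger0_norm ?addr_ge0 ?cstar_ge0//.
by have := cstar_ge0 pC z; lra.
Qed.

Context (E : hilbertModType A).

Definition ractr (a : A) (x : E) := ract x a.

Let ractr_linear a : linear (ractr a).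
Proof. by move=> k x y; rewrite /ractr ractDl ractZl. Qed.

HB.instance Definition _ a :=
  GRing.isLinear.Build R[i] E E _ (ractr a) (ractr_linear a).

(** [cstar_pos_ball] is used on both sides of [<x, x>], the second time after taking adjoints. *)
Lemma ractr_bound (p : A -> R) (a : A) (x : E) : cstar_seminorm p ->
  star a = a -> cstar_pos p a ->
  hseminorm p ((p a)%:C *: x - ractr a x) <= p a * hseminorm p x.
Proof.
move=> pC sa a0; have pa0 := cstar_ge0 pC a.
rewrite hseminorm_le ?mulr_ge0 ?hseminorm_ge0//.
pose w := (p a)%:C *: inner x x - amul (inner x x) a.
have -> : inner ((p a)%:C *: x - ractr a x) ((p a)%:C *: x - ractr a x) =
    (p a)%:C *: w - amul a w.
  rewrite innerBl innerZlr inner_ractl sa /w linearB /= innerZr inner_ract.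
  by [].
rewrite (le_trans (cstar_pos_ball pC sa a0 w))// exprMn hseminorm_sqr// expr2 -mulrA ler_wpM2l//.
rewrite -cstar_star// /w raddfB /= starZ starM sa inner_star conjc_realE.
exact: cstar_pos_ball.
Qed.

(* [x = d (1 + h)^-1] and [k = h (1 + h)^-1] for [h = <d, d>]. *)
Lemma truncation (d : E) : exists x : E,
  (forall p, S p -> hseminorm p x <= 1) /\
  (forall p, S p -> hseminorm p d <= 1 -> hseminorm p (d - x) <= 3 / 4).
Proof.
pose h := inner d d.
have sh : star h = h by rewrite inner_star.
have hp p : S p -> cstar_pos p h by move=> [pC _]; exact: inner_pos.
(* Identities such as [k^* = k] and [<x, x> = k - k^2] are checked after multiplication by the
   injective [1 + h]. *)
have inj z : z + amul h z = 0 -> z = 0 by exact: cstar_pos_resolvent_inj.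
have [|x xd] := @resolvent_surjective _ _ E (ractr h) _ d.
  move=> p Sp; have pC := proj1 Sp; exists (p h); first exact: cstar_ge0.
  by move=> y; apply: ractr_bound => //; exact: hp.
pose k := inner d x; rewrite /ractr in xd.
have hk : h = k + amul k h by rewrite /k -inner_ract -innerDr xd.
have hks : h = star k + amul h (star k) by rewrite -{1}sh {1}hk starD starM sh.
have comm : amul (star k) h = amul h (star k).
  apply/eqP; rewrite -subr_eq0; apply/eqP/inj.
  rewrite linearB /= addrACA -opprD amulA -amulDl -hks.
  by rewrite -linearD /= -hks subrr.
have hk' : h = k + amul h k.
  have e1 : h = star k + amul (star k) h by rewrite comm.
  by rewrite -{1}sh {1}e1 starD starM starK sh.
have sk : star k = k.
  apply/esym/subr0_eq/inj; rewrite linearB /= addrACA -opprD.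
  by rewrite -hk' -hks subrr.
have {}comm : amul k h = amul h k by rewrite -{1}sk comm sk.
have kx : k = inner x x + amul h (inner x x).
  by rewrite {1}/k -{1}xd innerDl inner_ractl sh.
have xk : inner x x = k - amul k k.
  have e1 : k - amul k k + amul h (k - amul k k) = k.
    transitivity (k + amul h k - amul (k + amul h k) k).
      by rewrite linearB /= amulA amulDl opprD addrACA.
    by rewrite -hk' {1}hk' addrK.
  by apply/subr0_eq/inj; rewrite (linearB (amul h)) /= addrACA -opprD -kx e1 subrr.
have kkE : amul k k = amul (star k) k by rewrite sk.
have kkp p : S p -> cstar_pos p (amul k k).
  by move=> [pC _]; rewrite kkE; apply: positive_cstar_pos => //; exists k.
have kkE2 p : S p -> p (amul k k) = p k ^+ 2 by move=> [pC _]; rewrite kkE cstar_sqr.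
have kxk : k = amul k k + inner x x by rewrite xk addrC subrK.
have k1 p : S p -> p k <= 1.
  move=> Sp; have pC := proj1 Sp; have := cstar_ge0 pC k.
  rewrite le_eqVlt => /predU1P[<-//|k0].
  have : p (amul k k) <= p (amul k k + inner x x).
    by apply: (cstar_pos_le pC) => //; [rewrite starM sk|exact: kkp|exact: inner_pos].
  by rewrite -kxk kkE2// expr2 -[leRHS]mul1r ler_pM2r.
exists x; split=> p Sp; have pC := proj1 Sp.
  rewrite hseminorm_le// expr1n (le_trans _ (k1 p Sp))//.
  by rewrite [in leRHS]kxk addrC inner_le//; exact: kkp.
have -> : d - x = ract d k.
  have -> : d - x = ract x h by rewrite -[in LHS]xd addrAC subrr add0r.
  by rewrite {1}hk' -[in RHS]xd ractDl -ractM -ractDr.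
rewrite hseminorm_le// => hd; rewrite hseminorm_le ?divr_ge0// inner_ract inner_ractl sk -/h.
rewrite expr1n -/h in hd.
(* Thus [2 k^2 <= h]; with [p h <= 1] this gives [p k ^+ 2 <= 1/2] and
   [p (k h k) <= 1/2 <= (3/4)^2]. *)
have hE : h = amul k k + amul k k + (inner x x + amul (amul k h) k).
  rewrite {1}hk {1}kxk -addrA -[in RHS]addrA; congr (_ + _).
  rewrite [in RHS]addrCA; congr (_ + _).
  by rewrite {1}hk' linearD /= amulA.
have k2 : p (amul k k + amul k k) <= p h.
  rewrite [in leRHS]hE; apply: (cstar_pos_le pC) => //.
  - by rewrite starD starM sk.
  - by apply: cstar_posD => //; exact: kkp.
  - apply: cstar_posD => //; first exact: inner_pos.
    rewrite -{1}sk -inner_ractl -inner_ract; exact: inner_pos.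
have k2E : p (amul k k + amul k k) = 2 * p k ^+ 2.
  rewrite -[amul k k]scale1r -scalerDl -(rmorph1 (real_complex R)) -rmorphD cstarZ//.
  by rewrite ger0_norm// kkE2.
rewrite k2E in k2; rewrite (le_trans (cstarM pC _ _))//.
have := cstarM pC k h; have k0 := cstar_ge0 pC k; have h0 := cstar_ge0 pC h.
move=> /(ler_wpM2r k0); move: (p (amul k h)) (p h) (p k) hd k2 k0 h0 => u v w v1 wv w0 v0 uw.
have : w ^+ 2 * v <= w ^+ 2 by rewrite ler_piMr// sqr_ge0.
by rewrite expr2 in wv *; lra.
Qed.

End truncation.

(** * Automatic boundedness of adjointable maps *)

Section automatic_continuity.
Context (R : realType) (A : locallyCstarType R).
Local Notation S := (@continuous_cstar_seminorms R A).

Lemma exprV16_lt (e : R) : 0 < e -> exists n, 16^-1 ^+ n < e.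
Proof.
have /cvgrPdist_lt : (fun n => 16^-1 ^+ n) @ \oo --> (0 : R).
  by apply: cvg_expr; rewrite ger0_norm ?invr_ge0// invf_lt1// ltr1n.
move=> H e0; have /filter_ex [n] := H e e0; rewrite sub0r normrN ger0_norm ?exprn_ge0 ?invr_ge0//.
by exists n.
Qed.

Lemma geometric_cvg (E : hilbertModType A) (c : nat -> E) :
  (forall p n, S p -> hseminorm p (c n.+1 - c n) <= 16^-1 ^+ n) ->
  exists l, forall p n, S p -> hseminorm p (l - c n) <= 16 / 15 * 16^-1 ^+ n.
Proof.
move=> cS; have r0 n : 0 < 16^-1 ^+ n :> R by rewrite exprn_gt0// invr_gt0.
have cd p n k : S p ->
    hseminorm p (c (n + k)%N - c n) <= 16 / 15 * (16^-1 ^+ n - 16^-1 ^+ (n + k)%N).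
  move=> Sp; have pC := proj1 Sp; elim: k => [|k IH].
    by rewrite addn0 !subrr mulr0 hseminorm0.
  have := hseminormD pC (c (n + k).+1 - c (n + k)%N) (c (n + k)%N - c n).
  rewrite addrA subrK addnS => /le_trans; apply.
  by have := cS p (n + k)%N Sp; rewrite exprS; lra.
have cle p m n : S p -> (n <= m)%N -> hseminorm p (c m - c n) <= 16 / 15 * 16^-1 ^+ n.
  move=> Sp /subnKC <-; rewrite (le_trans (cd _ _ _ Sp))//.
  by have := r0 (n + (m - n))%N; lra.
have [|||l lP] := @hilbert_completeP R A E
    (fun p e => [set c n | n in [set n | 16^-1 ^+ n < e / 2]]).
- move=> p e Sp e0; have e20 : 0 < e / 2 by rewrite divr_gt0.
  by have [n ne] := exprV16_lt e20; exists (c n), n.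
- move=> p q e d Sp Sq e0 d0 _ [n /= + <-].
  have : Num.min e d <= e by rewrite ge_min lexx.
  have : Num.min e d <= d by rewrite ge_min lexx orbT.
  by move=> *; split; exists n => //=; lra.
- move=> p e _ _ Sp e0 [m /= me <-] [n /= ne <-].
  have [mn|/ltnW nm] := leqP m n; last by have := cle p m n Sp nm; lra.
  by rewrite hseminormB ?(proj1 Sp)//; have := cle p n m Sp mn; lra.
exists l => p n Sp; have pC := proj1 Sp; apply/ler_addgt0Pr => e e0.
have e'0 : 0 < Num.min e (16^-1 ^+ n) by rewrite lt_min e0 r0.
have [_ [m /= me <-]] := lP p _ Sp e'0; rewrite lt_min => /andP[le_ _].
have nm : (n <= m)%N.
  rewrite leqNgt; apply/negP => /ltnW mn.
  have : 16^-1 ^+ n <= 16^-1 ^+ m :> R by rewrite ler_wiXn2l// ?invr_ge0// invf_le1// ler1n.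
  have : Num.min e (16^-1 ^+ n) <= 16^-1 ^+ n by rewrite ge_min lexx orbT.
  by have := r0 n; move: me; lra.
have := hseminormD pC (l - c m) (c m - c n); rewrite addrA subrK.
by have := cle p m n Sp nm; move: le_; lra.
Qed.

(* Gliding hump: were [T] unbounded for [p], the functionals
   [v |-> p (inner (T (x n)) v)] would be pointwise bounded in [n], but not at
   the limit of a well-chosen sequence. *)
Lemma adjointable_bounded (E F : hilbertModType A) (T : adjointable E F)
    (p : A -> R) : S p ->
  exists2 c, 0 < c & forall x, hseminorm p (T x) <= c * hseminorm p x.
Proof.
move=> Sp; have pC := proj1 Sp; apply: contrapT => unbounded.
pose r n : R := 16^-1 ^+ n.
have r0 n : 0 < r n by rewrite exprn_gt0// invr_gt0.
(* The pairing with the limit will be at least [(1/8 - 1/15) r_n b_n], where [1/15] is the geometric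
   tail, and [20 (1/8 - 1/15) > 1]. *)
pose M n : R := 20 * n.+1%:R / r n.
have M0 n : 0 < M n by rewrite divr_gt0// mulr_gt0.
have /choice [x xP] : forall n, exists x, hseminorm p x <= 1 /\ M n < hseminorm p (T x).
  move=> n; apply: contrapT => nx; apply: unbounded; exists (M n) => // x.
  rewrite leNgt; apply/negP => Mx.
  have x0 : 0 < hseminorm p x.
    rewrite lt_def hseminorm_ge0 andbT; apply/eqP => x0; move: Mx.
    rewrite x0 mulr0 ltNge => /negP; apply.
    rewrite hseminorm_le// adjP (le_trans (inner_hseminorm pC _ _))//.
    by rewrite x0 mul0r expr0n.
  apply: nx; exists ((hseminorm p x)^-1%:C *: x).
  rewrite linearZ /= !hseminormZ// gtr0_norm ?invr_gt0// mulVf ?gt_eqF//; split=> //.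
  by rewrite mulrC ltr_pdivlMr.
pose y n := T (x n); pose b n := hseminorm p (y n).
have b0 n : 0 < b n by rewrite (lt_trans (M0 n))//; case: (xP n).
(* Dividing by [b n] normalises [y n] for [p] only; truncation bounds it by 1 in every seminorm,
   hence makes it summable with weights [r n], and keeps a quarter of its pairing with [y n]. *)
have /choice [e eP] := fun n => truncation ((b n)^-1%:C *: y n).
have Le n : b n / 4 <= p (inner (y n) (e n)).
  have [_ /(_ p Sp)] := eP n.
  rewrite hseminormZ// gtr0_norm ?invr_gt0// mulVf ?gt_eqF// lexx => /(_ isT) de.
  have := inner_hseminorm pC (y n) ((b n)^-1%:C *: y n - e n).
  have := cstarD pC (inner (y n) ((b n)^-1%:C *: y n - e n)) (inner (y n) (e n)).
  rewrite -linearD /= subrK innerZr cstarZ// gtr0_norm ?invr_gt0//.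
  rewrite -hseminorm_sqr// -/(b n) expr2 mulKf ?gt_eqF//.
  move: (p _) (p _) => u v buv vb.
  have : b n * hseminorm p ((b n)^-1%:C *: y n - e n) <= b n * (3 / 4).
    by rewrite ler_wpM2l// ltW.
  by move: buv vb; lra.
(* A hump contributes at least [r n * b n / 4]; if the current vector pairs to less than half of
   that, adding the hump reaches that half. *)
pose step n v := if r n * b n / 8 <= p (inner (y n) v) then v else v + (r n)%:C *: e n.
pose c n := iteri n step 0.
have Lc n : r n * b n / 8 <= p (inner (y n) (c n.+1)).
  rewrite /c /= -/(c n) /step; case: ifPn => // /negP/negP; rewrite -ltNge => cn.
  have := cstarD pC (inner (y n) (c n + (r n)%:C *: e n)) (- inner (y n) (c n)).
  rewrite cstarN// -linearN -linearD /= addrAC subrr add0r innerZr cstarZ// gtr0_norm//.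
  have : r n * (b n / 4) <= r n * p (inner (y n) (e n)) by rewrite ler_wpM2l// ltW.
  by move: cn; lra.
have [|l lP] := @geometric_cvg F c.
  move=> q n Sq; rewrite /c /= -/(c n) /step; case: ifPn => _.
    rewrite subrr hseminorm0; [exact: (ltW (r0 n))|exact: proj1 Sq].
  rewrite addrC addKr hseminormZ; last exact: proj1 Sq.
  rewrite gtr0_norm// -[leRHS]mulr1 ler_wpM2l//; first exact: (ltW (r0 n)).
  by case: (eP n) => /(_ q Sq).
have [n nl] : exists n, hseminorm p (adj T l) < n%:R.
  by exists (Num.bound (hseminorm p (adj T l))); rewrite archi_boundP// hseminorm_ge0.
have [x1 Mb] := xP n; rewrite -/(y n) -/(b n) in Mb.
have := inner_hseminorm pC (x n) (adj T l); rewrite -adjP -/(y n) => yl.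
have := inner_hseminorm pC (y n) (c n.+1 - l); rewrite -/(b n) => bcl.
have := lP p n.+1 Sp; rewrite hseminormB// exprS -/(r n) => cl.
have := cstarD pC (inner (y n) (c n.+1 - l)) (inner (y n) l).
rewrite -innerDr subrK => ycl.
have : b n * hseminorm p (c n.+1 - l) <= b n * (16 / 15 * (16^-1 * r n)).
  by rewrite ler_wpM2l// ltW.
have : hseminorm p (x n) * hseminorm p (adj T l) <= hseminorm p (adj T l).
  by rewrite ler_piMl// hseminorm_ge0.
have : 20 * n.+1%:R <= b n * r n by move: Mb; rewrite ltr_pdivrMr// => /ltW.
have := Lc n; move: yl bcl ycl nl.
have : n.+1%:R = n%:R + 1 :> R by rewrite natr1.
have : 0 <= n%:R :> R by [].
by lra.
Qed.

End automatic_continuity.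

(** * Unitaries from pairs of maps with equal inner products *)

Section isometric_pair.
Context (R : realType) (A : locallyCstarType R).
Local Notation S := (@continuous_cstar_seminorms R A).

Definition approximable (X : Type) (E : preHilbertModType A) (K : X -> E) :=
  forall p e y, S p -> 0 < e -> exists x, hseminorm p (y - K x) < e.

(** The closure of the correspondence [K z |-> Z z], kept as a relation: [X] carries no structure,
    and the properties of the extension are read off from inner products. *)
Definition closed_graph (X : Type) (E F : preHilbertModType A)
    (K : X -> E) (Z : X -> F) x y :=
  forall p e, S p -> 0 < e ->
    exists z, hseminorm p (x - K z) < e /\ hseminorm p (y - Z z) < e.

Lemma inner_approx (E : preHilbertModType A) (p : A -> R) (x x' y y' : E) e :
  cstar_seminorm p -> e <= 1 -> hseminorm p (x - x') < e -> hseminorm p (y - y') < e ->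
  p (inner x y - inner x' y') <= e * (hseminorm p x + hseminorm p y + 1).
Proof.
move=> pC e1 xe ye.
have -> : inner x y - inner x' y' = inner (x - x') y + inner x' (y - y').
  by rewrite innerBl linearB /= addrA subrK.
rewrite (le_trans (cstarD pC _ _))//.
have := inner_hseminorm pC (x - x') y; have := inner_hseminorm pC x' (y - y').
have : hseminorm p x' <= hseminorm p x + 1.
  by have := hseminormD pC (x' - x) x; rewrite subrK hseminormB//; lra.
have := hseminorm_ge0 p x'; have := hseminorm_ge0 p y; have := hseminorm_ge0 p x.
have := hseminorm_ge0 p (x - x'); have := hseminorm_ge0 p (y - y').
move: xe ye; move: (hseminorm p (x - x')) (hseminorm p (y - y')) => u v.
move: (hseminorm p x) (hseminorm p y) (hseminorm p x') => a b a' ue ve v0 u0 a0 b0 a'0 aa h1 h2.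
have : u * b <= e * b by rewrite ler_wpM2r// ltW.
have : a' * v <= (a + 1) * e by rewrite ler_pM// ltW.
by move: h1 h2; lra.
Qed.

Context (X : Type) (E F : preHilbertModType A) (K : X -> E) (Z : X -> F).
Hypothesis KZ : forall x y, inner (K x) (K y) = inner (Z x) (Z y).

Lemma isometric_pair_hseminorm p x y :
  hseminorm p (K x - K y) = hseminorm p (Z x - Z y).
Proof. by rewrite /hseminorm !innerBl !linearB /= !KZ. Qed.

Lemma closed_graph_inner x x' y y' :
  closed_graph K Z x y -> closed_graph K Z x' y' -> inner x x' = inner y y'.
Proof.
move=> xy xy'; apply/subr0_eq/locally_cstar_eq0 => p Sp; have pC := proj1 Sp.
apply/le_anti; rewrite cstar_ge0// andbT; apply/ler_addgt0Pr => e e0; rewrite add0r.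
have h0 (G : preHilbertModType A) (g : G) : 0 <= hseminorm p g := hseminorm_ge0 p g.
pose C := (hseminorm p x + hseminorm p x' + 1) + (hseminorm p y + hseminorm p y' + 1).
have C0 : 0 < C by have := h0 _ x; have := h0 _ x'; have := h0 _ y; have := h0 _ y'; rewrite /C; lra.
have d0 : 0 < Num.min 1 (e / C) by rewrite lt_min ltr01 divr_gt0.
have d1 : Num.min 1 (e / C) <= 1 by rewrite ge_min lexx.
have [z [zx zy]] := xy p _ Sp d0; have [z' [zx' zy']] := xy' p _ Sp d0.
have h1 := inner_approx pC d1 zx zx'; have h2 := inner_approx pC d1 zy zy'.
rewrite KZ in h1.
have := cstarD pC (inner x x' - inner (Z z) (Z z')) (- (inner y y' - inner (Z z) (Z z'))).
rewrite cstarN// opprB addrA subrK => /le_trans; apply.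
rewrite (le_trans (lerD h1 h2))// -mulrDr -ler_pdivlMr//.
by rewrite ge_min lexx orbT.
Qed.

End isometric_pair.

Section unitary_equivalence.
Context (R : realType) (A : locallyCstarType R).
Local Notation S := (@continuous_cstar_seminorms R A).

Lemma closed_graph_total (X : Type) (E : preHilbertModType A) (F : hilbertModType A)
    (K : X -> E) (Z : X -> F) :
  (forall x y, inner (K x) (K y) = inner (Z x) (Z y)) -> approximable K ->
  forall x, exists y, closed_graph K Z x y.
Proof.
move=> KZ dK x.
have [|||y yP] := @hilbert_completeP R A F
    (fun p e => [set Z z | z in [set z | hseminorm p (x - K z) < e]]).
- by move=> p e Sp e0; have [z ze] := dK p e x Sp e0; exists (Z z), z.
- move=> p q e d Sp Sq e0 d0 _ [z /= + <-]; rewrite lt_min => /andP[ze zd].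
  split; exists z => //=.
    exact: le_lt_trans (hseminorm_le_max _ _ _) ze.
  exact: le_lt_trans (hseminorm_le_maxr _ _ _) zd.
- move=> p e _ _ Sp e0 [z /= ze <-] [z' /= ze' <-]; have pC := proj1 Sp.
  rewrite -(isometric_pair_hseminorm KZ).
  have := hseminormD pC (K z - x) (x - K z'); rewrite addrA subrK hseminormB//.
  by lra.
by exists y => p e Sp e0; have [_ [z /= zx <-] yz] := yP p e Sp e0; exists z.
Qed.

(** Closing the pair in both directions gives [U] and [V]; comparing inner products of points of the
    closed graph shows that [V] is both adjoint and inverse to [U]. *)
Lemma isometric_pair_unitarily_equivalent (X : Type) (E F : hilbertModType A)
    (K : X -> E) (Z : X -> F) :
  (forall x y, inner (K x) (K y) = inner (Z x) (Z y)) ->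
  approximable K -> approximable Z -> unitarily_equivalent E F.
Proof.
move=> KZ dK dZ.
have /choice [U UP] := closed_graph_total KZ dK.
have /choice [V VP'] := closed_graph_total (fun x y => esym (KZ x y)) dZ.
have VP y : closed_graph K Z (V y) y.
  by move=> p e Sp e0; have [z []] := VP' y p e Sp e0; exists z.
have inn := closed_graph_inner KZ.
have UV x y : inner (U x) y = inner x (V y) by apply/esym/inn.
exists (adjointable_of UV); split; apply/funext => x /=; apply: inner_inj => y.
  by rewrite -UV; exact/esym/inn.
by rewrite -(inn _ _ _ _ (VP y) (UP _)) -(inn _ _ _ _ (VP y) (VP x)).
Qed.

End unitary_equivalence.

(** * The absolute value of a contraction *)

Section absolute_value.
Context (R : realType) (A : locallyCstarType R).
Local Notation S := (@continuous_cstar_seminorms R A).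

Lemma le0_vissr (a C : R) : 0 <= C -> (forall n, a <= (1 - vissr R n) * C) -> a <= 0.
Proof.
move=> C0 aC; apply/ler_addgt0Pr => e e0; rewrite add0r.
have C1 : 0 < C + 1 by rewrite ltr_wpDl.
have [n ne] := vissr_cvg1P (divr_gt0 e0 C1).
rewrite (le_trans (aC n))// (le_trans (ler_wpM2r C0 ne))// mulrAC ler_pdivrMr//.
by rewrite ler_pM2l// lerDl.
Qed.

(** [W = 1 - Z^* Z] is a contraction for every seminorm, so the maps [k n] converge to the root of
    [1 - W = Z^* Z] with the relative error [1 - vissr R n] common to all seminorms. *)
Lemma contraction_absolute_value (E F : hilbertModType A) (Z : adjointable E F) :
  (forall p x, S p -> hseminorm p (Z x) <= hseminorm p x) ->
  exists K : E -> E, (forall x y, inner (K x) (K y) = inner (Z x) (Z y)) /\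
    (forall x y, inner (K x) y = inner x (K y)).
Proof.
move=> Z1.
have fg x y : inner (x - adj Z (Z x)) y = inner x (y - adj Z (Z y)).
  by rewrite innerBl [RHS]linearB /= adj_op adjP.
pose W : {linear E -> E} := adjointable_of fg.
have W1 p : S p -> op_bound (hseminorm p) W 'X 1.
  move=> Sp x; rewrite horner_opX mul1r; apply: contraction_sub; first exact: proj1 Sp.
  by move=> y; exact: Z1.
pose k n : E -> E := horner_op W (1 - visser 'X n).
have v1 n : 0 <= 1 - vissr R n by have /andP[_] := vissr_itv R n; rewrite subr_ge0.
have kB p m n x : S p -> (n <= m)%N ->
    hseminorm p (k m x - k n x) <= (1 - vissr R n) * hseminorm p x.
  move=> Sp nm; have pC := proj1 Sp.
  have -> : k m x - k n x = horner_op W (visser 'X n - visser 'X m) x.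
    apply: (addIr (k n x)); rewrite subrK -horner_opD.
    by congr (horner_op W _ x); ring.
  have := visser_diff_bound (hseminormD pC) (hseminormZ pC) (W1 p Sp) nm.
  move=> /(op_boundN (hseminormD pC) (hseminormZ pC)) /(_ x); rewrite opprB.
  move=> /le_trans; apply; rewrite ler_wpM2r ?hseminorm_ge0//.
  by have /andP[_] := vissr_itv R m; lra.
have /choice [K KP] : forall x, exists l, forall p n, S p ->
    hseminorm p (l - k n x) <= (1 - vissr R n) * hseminorm p x.
  move=> x.
  have [|||l lP] := @hilbert_completeP R A E
    (fun p e => [set k n x | n in [set n | (1 - vissr R n) * hseminorm p x < e]]).
  - move=> p e Sp e0; have x1 : 0 < hseminorm p x + 1 by rewrite ltr_wpDl// hseminorm_ge0.
    have [n ne] := vissr_cvg1P (divr_gt0 e0 x1); exists (k n x), n => //=.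
    rewrite (le_lt_trans (ler_wpM2r (hseminorm_ge0 p x) ne))// mulrAC ltr_pdivrMr//.
    by rewrite ltr_pM2l// ltrDl.
  - move=> p q e d Sp Sq e0 d0 _ [n /= + <-]; rewrite lt_min => /andP[ne nd].
    split; exists n => //=; [apply: le_lt_trans ne|apply: le_lt_trans nd].
      by rewrite ler_wpM2l// hseminorm_le_max.
    by rewrite ler_wpM2l// hseminorm_le_maxr.
  - move=> p e _ _ Sp e0 [m /= me <-] [n /= ne <-].
    have [mn|/ltnW nm] := leqP m n; last by have := kB p m n x Sp nm; lra.
    by rewrite hseminormB ?(proj1 Sp)//; have := kB p n m x Sp mn; lra.
  exists l => p n Sp; have pC := proj1 Sp; apply/ler_addgt0Pr => e e0.
  have [_ [m /= me <-] le_] := lP p _ Sp (divr_gt0 e0 (ltr0n _ 2)).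
  have [nm|/ltnW mn] := leqP n m.
    have := hseminormD pC (l - k m x) (k m x - k n x); rewrite addrA subrK.
    by have := kB p m n x Sp nm; move: le_; lra.
  have := hseminormD pC (l - k m x) (k m x - k n x); rewrite addrA subrK.
  rewrite [hseminorm p (k m x - _)]hseminormB//.
  have := kB p n m x Sp mn; have := mulr_ge0 (v1 n) (hseminorm_ge0 p x).
  by move: me le_; lra.
have kadj n x y : inner (k n x) y = inner x (k n y).
  apply: horner_op_adj => //.
  - by move=> u v w; rewrite innerDl.
  - by move=> u v w; rewrite innerDr.
  - by move=> a u v; rewrite innerZlr.
  - by move=> a u v; rewrite innerZr.
have kk n x : k n (k n x) = adj Z (Z x) - horner_op W (1 - 'X - (1 - visser 'X n) ^+ 2) x.
  apply: (addIr (horner_op W (1 - 'X - (1 - visser 'X n) ^+ 2) x)); rewrite subrK.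
  rewrite /k -horner_opM -expr2 -horner_opD addrC subrK.
  have := horner_op_subX W 1 x; rewrite scale1r polyC1 => ->.
  by rewrite /= opprB addrC subrK.
have kerr p n x : S p ->
    hseminorm p (horner_op W (1 - 'X - (1 - visser 'X n) ^+ 2) x) <= (1 - vissr R n) * hseminorm p x.
  move=> Sp; have pC := proj1 Sp; rewrite visser_sqrt -opprB mulrN.
  have := op_boundN (hseminormD pC) (hseminormZ pC) (op_boundZ (hseminormZ pC) 2
    (visser_step_bound (hseminormD pC) (hseminormZ pC) n (W1 p Sp))) x.
  move=> /le_trans; apply; rewrite ler_wpM2r ?hseminorm_ge0// vissr_step ger0_norm//.
  rewrite mulrA divff// mul1r expr2 ler_piMr// lerBlDr lerDl.
  by have /andP[] := vissr_itv R n.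
exists K; split=> x y; apply/subr0_eq/locally_cstar_eq0 => p Sp; have pC := proj1 Sp.
all: apply/le_anti; rewrite cstar_ge0// andbT.
all: have x0 := hseminorm_ge0 p x; have y0 := hseminorm_ge0 p y.
all: have Kx0 := hseminorm_ge0 p (K x); have Ky0 := hseminorm_ge0 p (K y).
  apply: (@le0_vissr _ (hseminorm p x * hseminorm p (K y) +
    (hseminorm p (K x) + hseminorm p x) * hseminorm p y + hseminorm p x * hseminorm p y)).
    by rewrite !(addr_ge0, mulr_ge0).
  move=> n; set dl := 1 - vissr R n; have dl0 : 0 <= dl := v1 n.
  have dl1 : dl <= 1 by have /andP[] := vissr_itv R n; rewrite /dl; lra.
  have -> : inner (K x) (K y) - inner (Z x) (Z y) =
      (inner (K x - k n x) (K y) + inner (k n x) (K y - k n y)) -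
      inner x (horner_op W (1 - 'X - (1 - visser 'X n) ^+ 2) y).
    rewrite innerBl linearB /= addrA subrK kadj kk linearB /= -adjP.
    by rewrite opprB addrA addrAC addrK.
  rewrite (le_trans (cstarD pC _ _))// cstarN//.
  rewrite (le_trans (lerD (cstarD pC _ _) (inner_hseminorm pC _ _)))//.
  rewrite (le_trans (lerD (lerD (inner_hseminorm pC _ _) (inner_hseminorm pC _ _)) (lexx _)))//.
  have kx : hseminorm p (k n x) <= hseminorm p (K x) + hseminorm p x.
    have := hseminormD pC (k n x - K x) (K x); rewrite subrK hseminormB//.
    have := KP x p n Sp; rewrite -/dl.
    have : dl * hseminorm p x <= hseminorm p x by rewrite ler_piMl.
    by lra.
  have h1 := ler_wpM2r Ky0 (KP x p n Sp).
  have h2 := ler_pM (hseminorm_ge0 p _) (hseminorm_ge0 p _) kx (KP y p n Sp).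
  have h3 := ler_wpM2l x0 (kerr p n y Sp).
  by move: h1 h2 h3; rewrite -/dl; lra.
apply: (@le0_vissr _ (2 * hseminorm p x * hseminorm p y)).
  by rewrite !mulr_ge0.
move=> n.
have -> : inner (K x) y - inner x (K y) = inner (K x - k n x) y - inner x (K y - k n y).
  by rewrite innerBl [inner x (_ - _)]linearB /= kadj opprB addrA subrK.
rewrite (le_trans (cstarD pC _ _))// cstarN//.
rewrite (le_trans (lerD (inner_hseminorm pC _ _) (inner_hseminorm pC _ _)))//.
have h1 := ler_wpM2r y0 (KP x p n Sp); have h2 := ler_wpM2l x0 (KP y p n Sp).
by move: h1 h2; lra.
Qed.

End absolute_value.

(** * Replacing an operator by a contraction *)

Section normalisation.
Context (R : realType) (A : locallyCstarType R).
Local Notation S := (@continuous_cstar_seminorms R A).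

(* [Z] is [T (1 + T^* T)^-1]. *)
Lemma contraction_same_ranges (E F : hilbertModType A) (T : adjointable E F) :
  exists Z : adjointable E F,
    [/\ forall p x, S p -> hseminorm p (Z x) <= hseminorm p x,
        range T `<=` range Z & range (adj T) `<=` range (adj Z)].
Proof.
pose H : {linear E -> E} := adj T \o T.
have Hb p : S p -> exists2 t, 0 <= t &
    forall x : E, hseminorm p (t%:C *: x - H x) <= t * hseminorm p x.
  move=> Sp; have [c c0 Tc] := adjointable_bounded T Sp; exists (c ^+ 2).
    exact: sqr_ge0.
  by move=> x; apply: square_sub_bound => //; exact: proj1 Sp.
have /choice [G GP] := resolvent_surjective Hb.
have GK x : G (x + H x) = x.
  apply/subr0_eq/hseminorm_eq0 => p Sp; have [t t0 Ht] := Hb p Sp.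
  have pC := proj1 Sp; apply/le_anti; rewrite hseminorm_ge0 andbT.
  rewrite (le_trans (resolvent_lower_bound pC t0 Ht _))// linearB addrACA -opprD GP.
  by rewrite subrr hseminorm0.
have Gadj x y : inner (G x) y = inner x (G y).
  by rewrite -{1}(GP y) -{2}(GP x) innerDl innerDr /= adj_op adjP.
have fg x y : inner (T (G x)) y = inner x (G (adj T y)) by rewrite adjP Gadj.
exists (adjointable_of fg); split.
- move=> p x Sp /=; have pC := proj1 Sp.
  rewrite ler_wsqrtr// -[in leRHS](GP x); move: (G x) => z.
  (* [<(1 + H) z, (1 + H) z>] exceeds [<T z, T z>] by a sum of positive terms. *)
  have -> : inner (z + H z) (z + H z) = inner (T z) (T z) +
      (inner (T z) (T z) + (inner z z + inner (H z) (H z))).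
    rewrite innerDl !innerDr [inner z (H z)]/= -adjP.
    have -> : inner (H z) z = inner (T z) (T z) by rewrite /= adj_op.
    by rewrite [inner z z + _]addrC -!addrA; congr (_ + _); rewrite addrCA.
  by apply: inner_le => //; do 2![apply: cstar_posD => //; first exact: inner_pos]; exact: inner_pos.
- by move=> _ [x _ <-]; exists (x + H x) => //=; rewrite GK.
(* The adjoint of [Z] is [G] after [adj T], and [x = adj T y] satisfies
   [x + H x = adj T (y + T x)]. *)
- move=> _ [y _ <-]; exists (y + T (adj T y)) => //=.
  have -> : adj T (y + T (adj T y)) = adj T y + H (adj T y) by rewrite linearD.
  by rewrite GK.
Qed.

End normalisation.

Theorem proposition3p8 (R : realType) (A : locallyCstarType R)
    (E F : hilbertModType A) :
  unitarily_equivalent E F <->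
  exists T : adjointable E F, dense (range T) /\ dense (range (adjoint T)).
Proof.
split=> [[U [UK KU]]|[T [dT dT']]].
  have surj (X : Type) (G : hilbertModType A) (f : X -> G) (g : G -> X) :
      f \o g = id -> dense (range f).
    move=> fg O [y Oy] _; exists y; split=> //; exists (g y) => //.
    by rewrite -[LHS]/((f \o g) y) fg.
  by exists U; split; [exact: surj KU|exact: surj UK].
have [Z [Z1 TZ TZ']] := contraction_same_ranges T.
have aZ : approximable Z.
  move=> p e y Sp e0; have [_ /TZ[x _ <-] ye] := dense_hseminorm dT y Sp e0.
  by exists x.
have [K [KZ Kadj]] := contraction_absolute_value Z1.
apply: (isometric_pair_unitarily_equivalent KZ _ aZ).
(* The range of [K] contains that of [K^2 = Z^* Z]: approximate [y] by [Z^* w] and [w] by [Z x], the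
   adjoint of [Z] being a contraction too. *)
move=> p e y Sp e0; have pC := proj1 Sp; have e20 : 0 < e / 2 by rewrite divr_gt0.
have [_ /TZ'[w _ <-] yw] := dense_hseminorm dT' y Sp e20.
have [x wx] := aZ p _ w Sp e20; exists (K x).
have -> : K (K x) = adj Z (Z x).
  by apply: inner_inj => z; rewrite -Kadj KZ adjP.
have := hseminormD pC (y - adj Z w) (adj Z w - adj Z (Z x)); rewrite addrA subrK.
rewrite -linearB /=.
have := adj_bound pC ler01 (fun x => _ : hseminorm p (Z x) <= 1 * hseminorm p x).
move=> /(_ (fun x => ltac:(rewrite mul1r; exact: Z1)) (w - Z x)); rewrite mul1r.
by move: yw wx; lra.
Qed.
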